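(* Let $\phi$ be a branching mechanism and let $x(\cdot)$ be a càdlàg realization of the CB-process with branching mechanism $\phi$, started at time $r\ge 0$ from $x\ge 0$ under the probability $\mathbf{Q}_{r,x}$. Suppose that $t\ge 0$ and $\mu$ is a finite measure supported by $[0,t]$. Let $s\mapsto\lambda(s)$ be a bounded positive Borel function on $[0,t]$. Then for all $x\ge 0$ and $0\le r\le t$ we have $$\mathbf{Q}_{r,x}\exp\bigg\{-\int_{[r,t]}\lambda(s)x(s)\,\mu(ds)\bigg\}=\exp\{-xu(r)\},$$ where $r\mapsto u(r)$ is the unique bounded positive solution on $[0,t]$ to $$u(r)+\int_r^t\phi(u(s))\,ds=\int_{[r,t]}\lambda(s)\,\mu(ds).$$
   Context: ''Positive'' means nonnegative. A branching mechanism is a function $\phi(z)=bz+cz^2+\int_{(0,\infty)}(e^{-zu}-1+zu)\,m(du)$, $z\ge 0$, with $b\in\mathbb{R}$, $c\ge 0$ and $m$ a $\sigma$-finite measure on $(0,\infty)$ with $\int_{(0,\infty)}(u\wedge u^2)\,m(du)<\infty$. For $\lambda\ge 0$ let $t\mapsto v_t(\lambda)$ be the unique positive solution of $v_t(\lambda)=\lambda-\int_0^t\phi(v_s(\lambda))\,ds$; the CB-process with branching mechanism $\phi$ is the Markov process in $[0,\infty)$ with (Feller) transition semigroup $(Q_t)_{t\ge 0}$ given by $\int_{[0,\infty)}e^{-\lambda y}Q_t(x,dy)=e^{-xv_t(\lambda)}$. Under $\mathbf{Q}_{r,x}$, the process $\{x(t):t\ge r\}$ is a càdlàg Markov process with transition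 semigroup $(Q_t)_{t\ge 0}$ and $x(r)=x$. $\mathbf{Q}_{r,x}$ applied to a random variable denotes its expectation. Solutions $u$ are understood to be Borel functions. *)

(* Defs.v *)
From HB Require Import structures.
From mathcomp Require Import all_boot all_order all_algebra.
From mathcomp Require Import all_classical all_reals all_analysis.
Set Implicit Arguments.
Unset Strict Implicit.
Unset Printing Implicit Defensive.
Import Order.TTheory GRing.Theory Num.Theory.
Import numFieldNormedType.Exports.
Local Open Scope classical_set_scope.
Local Open Scope ring_scope.

(* The measure m on (0, +oo) is represented by a measure on the line of which
   only the trace on (0, +oo) is used. For z >= 0 the integrand of phi is
   nonnegative and bounded by a multiple of min(u, u^2), so the real-valued
   integral is the true one. The values of phi at z < 0 are irrelevant. *)
Definition branching_mechanism (R : realType) (phi : R -> R) : Prop :=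
  exists (b c : R) (m : {measure set (measurableTypeR R) -> \bar R}),
    [/\ 0 <= c,
        sigma_finite (`]0, +oo[ : set (measurableTypeR R)) m,
        (\int[m]_(u in `]0%R, +oo[) (Num.min u (u ^+ 2))%:E < +oo)%E
      & forall z, 0 <= z ->
          phi z = b * z + c * z ^+ 2
            + \int[m]_(u in `]0, +oo[) (expR (- (z * u)) - 1 + z * u)].

(* w is a positive solution of w(t) = l - \int_0^t phi(w(s)) ds, t >= 0;
   integrability is required since Rintegral is total. *)
Definition cumulant_solution (R : realType) (phi : R -> R) (l : R)
    (w : R -> R) : Prop :=
  forall t, 0 <= t ->
    [/\ 0 <= w t,
        (@lebesgue_measure R).-integrable `[0, t] (EFin \o (phi \o w))
      & w t = l - \int[@lebesgue_measure R]_(s in `[0, t]) phi (w s)].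

(* The state space [0, +oo) is viewed inside the line: Q t x is constrained for
   t >= 0 and x >= 0 only, and is then carried by [0, +oo) (take l = 0). *)
Definition cb_semigroup (R : realType) (phi : R -> R)
    (Q : R -> R.-pker (measurableTypeR R) ~> (measurableTypeR R)) : Prop :=
  exists2 v : R -> R -> R,
    (forall l, 0 <= l -> cumulant_solution phi l (v ^~ l)) &
    forall t x l, 0 <= t -> 0 <= x -> 0 <= l ->
      (\int[Q t x]_(y in `[0%R, +oo[) (expR (- (l * y)))%:E
        = (expR (- (x * v t l)))%:E)%E.

Definition cadlag_from (R : realType) (r : R) (f : R -> R) : Prop :=
  (forall s, r <= s -> f @ s^'+ --> f s) /\
  (forall s, r < s -> cvg (f @ s^'-)).

(* The events of sigma(X u : r <= u <= s). *)
Definition natural_filtration (R : realType) (d : measure_display)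
    (Omega : measurableType d) (X : R -> Omega -> measurableTypeR R)
    (r s : R) : set (set Omega) :=
  <<s [set A | exists u B, [/\ r <= u, u <= s, measurable B
                             & A = X u @^-1` B]] >>.

(* Under P, (X s)_{s >= r} is a cadlag [0, +oo)-valued Markov process with
   transition kernels Q and initial value X r = x; the Markov property is
   P(X_{s'} \in B | F_s) = Q_{s'-s}(X_s, B), integrated over events A of F_s. *)
Definition cadlag_markov_process (R : realType)
    (Q : R -> R.-pker (measurableTypeR R) ~> (measurableTypeR R))
    (d : measure_display) (Omega : measurableType d)
    (P : probability Omega R) (X : R -> Omega -> measurableTypeR R)
    (r x : R) : Prop :=
  [/\ forall s, r <= s -> measurable_fun setT (X s),
      forall s w, r <= s -> 0 <= X s w,
      forall w, cadlag_from r (X ^~ w),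
      P [set w | X r w = x] = 1%E
    & forall s s' A B, r <= s -> s <= s' ->
        natural_filtration X r s A -> measurable B ->
        (P (A `&` X s' @^-1` B) = \int[P]_(w in A) Q (s' - s)%R (X s w) B)%E].

Definition bounded_positive_solution (R : realType) (phi : R -> R) (t : R)
    (mu : {finite_measure set (measurableTypeR R) -> \bar R})
    (lam : R -> R) (u : R -> R) : Prop :=
  [/\ measurable_fun (`[0, t] : set (measurableTypeR R))
        (u : measurableTypeR R -> measurableTypeR R),
      exists M, forall r, 0 <= r <= t -> 0 <= u r <= M
    & forall r, 0 <= r <= t ->
        u r + \int[@lebesgue_measure R]_(s in `[r, t]) phi (u s)
          = \int[mu]_(s in `[r, t]) lam s].

(* Main.v *)
(* Approximate mu by the atomic measures obtained by moving the mass at s to the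
   next point s_n of a grid of mesh 1/(n+1). For an atomic measure the Markov
   property, applied to the atoms from the last to the first, gives the Laplace
   transform exp(- x u_n(r)), where u_n follows the cumulant semigroup backwards
   in time and jumps at the atoms; hence u_n solves the integral equation of the
   discretized measure. As s_n tends to s from the right and paths are right
   continuous and locally bounded, the discretized functionals converge. So
   exp(- u_n(r)) converges, which makes u_n(r) converge to some u(r) without any
   Cauchy estimate, and the integral equation passes to the limit by dominated
   convergence. Since phi(z) >= - beta z, Gronwall bounds u_n uniformly; since
   phi is locally Lipschitz, Gronwall gives uniqueness. *)

Require Import Defs.
From HB Require Import structures.
From mathcomp Require Import all_boot all_order all_algebra.
From mathcomp Require Import all_classical all_reals all_analysis.
From mathcomp Require Import measurable_realfun.
From mathcomp Require Import ring lra.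
Set Implicit Arguments.
Unset Strict Implicit.
Unset Printing Implicit Defensive.
Import Order.TTheory GRing.Theory Num.Theory.
Import numFieldNormedType.Exports.
Local Open Scope classical_set_scope.
Local Open Scope ring_scope.

(** * Bounded functions on sets of finite measure *)

Lemma bounded_integrable d (T : measurableType d) (R : realType)
    (mu : {measure set T -> \bar R}) (D : set T) (f : T -> R) (C : R) :
  measurable D -> (mu D < +oo)%E -> measurable_fun D f ->
  (forall x, D x -> `|f x| <= C) -> mu.-integrable D (EFin \o f).
Proof.
move=> mD muD mf fC; apply: measurable_bounded_integrable => //.
exists C; split; first exact: num_real.
by move=> y Cy x Dx; exact: le_trans (fC x Dx) (ltW Cy).
Qed.

(** All limits below are of this kind: under [mu] for the discretized functionals, under the law of
    the process for their Laplace transforms, and under Lebesgue measure for the integral equation.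
    Finite mass of [D] makes the constant [C] an integrable bound. *)
Lemma bounded_convergence d (T : measurableType d) (R : realType)
    (mu : {measure set T -> \bar R}) (D : set T) (f_ : (T -> R)^nat)
    (f : T -> R) (C : R) :
  measurable D -> (mu D < +oo)%E -> (forall n, measurable_fun D (f_ n)) ->
  (forall n x, D x -> `|f_ n x| <= C) ->
  (forall x, D x -> f_ ^~ x @ \oo --> f x) ->
  \int[mu]_(x in D) f_ n x @[n --> \oo] --> \int[mu]_(x in D) f x.
Proof.
move=> mD muD mf_ f_C f_f.
have mf : measurable_fun D f by exact: measurable_fun_cvg f_f.
have fC x : D x -> `|f x| <= C.
  move=> Dx; apply: (cvgr_to_le (cvg_norm (f_f _ Dx))).
  by apply: nearW => n; exact: f_C.
have iC : mu.-integrable D (cst C%:E).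
  by apply: (@bounded_integrable _ _ _ _ _ (cst C) `|C|) => //.
have [||||_ _ cv] := @dominated_convergence _ _ _ mu D mD
    (fun n => EFin \o f_ n) (EFin \o f) (cst C%:E) _ _ _ iC.
- by move=> n; exact/measurable_EFinP.
- exact/measurable_EFinP.
- by apply: aeW => x Dx; apply: cvg_EFin; [exact: nearW|exact: f_f].
- by apply: aeW => x n Dx; rewrite lee_fin; exact: f_C.
apply: fine_cvg.
rewrite /Rintegral fineK//.
apply: integrable_fin_num => //; exact: bounded_integrable fC.
Qed.

(** * Branching mechanisms *)

Section branching_mechanism_properties.
Variable R : realType.
Implicit Types (z y u B : R).

Let h z u := expR (- (z * u)) - 1 + z * u.
Let q u := Num.min u (u ^+ 2).

(* With d = (z - y)u, the increment equals d - e^{-yu}(1 - e^{-d}); it is at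
   most d, and at most d(1 - e^{-zu}) because 1 - e^{-d} >= d e^{-d}. *)
Lemma compensated_exp_increment B z y u : 0 <= y -> y <= z -> z <= B -> 0 < u ->
  0 <= h z u - h y u <= (z - y) * ((1 + B) * Num.min u (u ^+ 2)).
Proof.
move=> y0 yz zB u0.
set d := (z - y) * u.
have d0 : 0 <= d by rewrite mulr_ge0 ?subr_ge0// ltW.
have zyd : z * u = y * u + d by rewrite /d; ring.
have -> : h z u - h y u = d - expR (- (y * u)) * (1 - expR (- d)).
  by rewrite /h zyd opprD expRD; ring.
have ey0 : 0 <= expR (- (y * u)) by exact: expR_ge0.
have ey1 : expR (- (y * u)) <= 1.
  by rewrite expR_le1 oppr_le0 mulr_ge0// ltW.
have ed : 1 - d <= expR (- d) by exact: expR_ge1Dx.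
have ed1 : expR (- d) <= 1 by rewrite expR_le1 oppr_le0.
apply/andP; split.
  nra.
have zu : 0 <= z * u by apply: mulr_ge0; [exact: le_trans yz|exact: ltW].
have ez : 1 - z * u <= expR (- (z * u)) by exact: expR_ge1Dx.
have de : expR (- d) * d <= 1 - expR (- d).
  have := ler_wpM2l (expR_ge0 (- d)) (expR_ge1Dx d).
  by rewrite mulrDr mulr1 [expR (- d) * expR d]mulrC expRxMexpNx_1; lra.
have b1 : d - expR (- (y * u)) * (1 - expR (- d)) <= d by nra.
have b2 : d - expR (- (y * u)) * (1 - expR (- d)) <= d * (z * u).
  have : expR (- (y * u)) * (expR (- d) * d) <=
         expR (- (y * u)) * (1 - expR (- d)) by exact: ler_wpM2l.
  rewrite mulrA -expRD -opprD -zyd => H.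
  have : (1 - z * u) * d <= expR (- (z * u)) * d by exact: ler_wpM2r.
  lra.
have B0 : 0 <= B by exact: le_trans (le_trans y0 yz) zB.
have zy0 : 0 <= z - y by rewrite subr_ge0.
(* The bound d serves large u, where the minimum is u; the bound d z u serves small u, where it is
   u^2. The factor 1 + B dominates both 1 and z. *)
case: (leP u (u ^+ 2)) => _.
  by apply: (le_trans b1); rewrite /d ler_wpM2l//; nra.
apply: (le_trans b2); rewrite /d -mulrA ler_wpM2l//.
have -> : u * (z * u) = z * u ^+ 2 by ring.
by rewrite ler_wpM2r ?sqr_ge0//; lra.
Qed.

Lemma compensated_exp_ge0 z u : 0 <= h z u.
Proof. by rewrite /h; have := expR_ge1Dx (- (z * u)); lra. Qed.

Lemma compensated_exp0 u : h 0 u = 0.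
Proof. by rewrite /h mul0r oppr0 expR0 subrr addr0. Qed.

Lemma measurable_compensated_exp z (D : set (measurableTypeR R)) :
  measurable_fun D (h z : measurableTypeR R -> measurableTypeR R).
Proof.
apply: (@measurable_funS _ _ _ _ setT) => //.
apply: measurable_funD => /=; last exact: measurable_funM.
apply: measurable_funB => //=.
apply: (@measurableT_comp _ _ _ _ _ _ expR) => //=.
by apply: measurableT_comp => //; exact: measurable_funM.
Qed.

Lemma measurable_min_sqr (D : set (measurableTypeR R)) :
  measurable_fun D (q : measurableTypeR R -> measurableTypeR R).
Proof.
apply: (@measurable_funS _ _ _ _ setT) => //.
by apply: measurable_minr => //; exact: measurable_funX.
Qed.

Section levy_measure.
Variable m : {measure set (measurableTypeR R) -> \bar R}.
Hypothesis m_fin :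
  (\int[m]_(u in `]0%R, +oo[) (Num.min u (u ^+ 2))%:E < +oo)%E.

Let D : set (measurableTypeR R) := `]0, +oo[.

Let mD : measurable D. Proof. exact: measurable_itv. Qed.

Let DP u : D u -> 0 < u.
Proof. by rewrite /D /= in_itv/= andbT. Qed.

Lemma integrable_min_sqr :
  m.-integrable D (EFin \o q).
Proof.
apply/integrableP; split; first by apply/measurable_EFinP; exact: measurable_min_sqr.
apply: le_lt_trans m_fin; rewrite le_eqVlt; apply/orP; left; apply/eqP.
apply: eq_integral => u; rewrite inE => /DP u0 /=.
by rewrite ger0_norm// le_min ltW//= sqr_ge0.
Qed.

Lemma integrable_compensated_exp z : 0 <= z ->
  m.-integrable D (EFin \o h z).
Proof.
move=> z0.
(* The increment bound between 0 and z, with B = z, gives the dominating function z (1 + z) min(u,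
   u^2). *)
have iC : m.-integrable D
    (EFin \o (fun u => z * (1 + z) * q u)).
  have -> : (EFin \o (fun u => z * (1 + z) * q u)) =
    (fun u => (z * (1 + z))%:E * (EFin \o q) u)%E by [].
  by apply: integrableZl => //; exact: integrable_min_sqr.
apply: le_integrable iC => //.
  by apply/measurable_EFinP; exact: measurable_compensated_exp.
move=> u /DP u0 /=; rewrite lee_fin.
have /andP[] := @compensated_exp_increment z z 0 u (lexx 0) z0 (lexx z) u0.
rewrite compensated_exp0 !subr0 mulrA => h0 hz.
by rewrite !ger0_norm// (le_trans h0).
Qed.

Lemma levy_integral_increment B z y : 0 <= y -> y <= z -> z <= B ->
  0 <= \int[m]_(u in D) h z u - \int[m]_(u in D) h y u
    <= (z - y) * ((1 + B) * \int[m]_(u in D) Num.min u (u ^+ 2)).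
Proof.
move=> y0 yz zB; have z0 := le_trans y0 yz.
rewrite -RintegralB//; [|exact: integrable_compensated_exp..].
apply/andP; split.
  apply: Rintegral_ge0 => u /DP u0.
  by have /andP[] := compensated_exp_increment y0 yz zB u0.
rewrite mulrA -RintegralZl//; last exact: integrable_min_sqr.
apply: le_Rintegral => //.
- rewrite (_ : _ \o _ = (EFin \o h z) \- (EFin \o h y))%E//.
  by apply: integrableB => //; exact: integrable_compensated_exp.
- rewrite (_ : _ \o _ = fun u => ((z - y) * (1 + B))%:E *
      (EFin \o q) u)%E//.
  by apply: integrableZl => //; exact: integrable_min_sqr.
- move=> u /DP u0.
  by have /andP[] := compensated_exp_increment y0 yz zB u0; rewrite mulrA.
Qed.

End levy_measure.

Variable phi : R -> R.
Hypothesis phi_bm : branching_mechanism phi.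

Lemma branching_mechanism0 : phi 0 = 0.
Proof.
case: phi_bm => [b [c [m [_ _ _ ->//]]]].
under eq_Rintegral do rewrite -/(h 0 _) compensated_exp0.
by rewrite Rintegral_cst//; ring.
Qed.

(** The quadratic and jump terms are nonnegative, so [beta] = |b| works. This linear lower bound is
    what prevents the backward equation from blowing up. *)
Lemma branching_mechanism_ge :
  exists2 beta, 0 <= beta & forall z, 0 <= z -> - (beta * z) <= phi z.
Proof.
case: phi_bm => [b [c [m [c0 _ _ phiE]]]].
exists `|b| => // z z0; rewrite phiE//.
have I0 : 0 <= \int[m]_(u in `]0, +oo[) h z u.
  by apply: Rintegral_ge0 => u _; exact: compensated_exp_ge0.
have cz : 0 <= c * z ^+ 2 by rewrite mulr_ge0// sqr_ge0.
have : - `|b| <= b by rewrite lerNl -normrN ler_norm.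
move=> /(ler_wpM2r z0); rewrite /h in I0 *; lra.
Qed.

Lemma branching_mechanism_lipschitz B : exists2 L, 0 <= L &
  forall y z, 0 <= y <= B -> 0 <= z <= B -> `|phi z - phi y| <= L * `|z - y|.
Proof.
case: phi_bm => [b [c [m [c0 _ m_fin phiE]]]].
set J := \int[m]_(u in `]0, +oo[) Num.min u (u ^+ 2).
have J0 : 0 <= J.
  apply: Rintegral_ge0 => u /=; rewrite in_itv/= andbT => u0.
  by rewrite le_min ltW//= sqr_ge0.
(* One term per part of phi: the linear part, z^2 - y^2 = (z + y)(z - y) with z + y <= 2B, and the
   jump integral. The absolute value of B keeps L nonnegative when B < 0 and [0, B] is empty. *)
pose L := `|b| + c * (2 * `|B|) + (1 + `|B|) * J.
have L0 : 0 <= L by rewrite /L !addr_ge0// ?mulr_ge0// ?addr_ge0.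
exists L => //.
suff main y z : 0 <= y -> y <= z -> z <= B -> `|phi z - phi y| <= L * `|z - y|.
  move=> y z /andP[y0 yB] /andP[z0 zB].
  have [yz|/ltW zy] := leP y z; first exact: main.
  by rewrite distrC [`|z - y|]distrC; exact: main.
move=> y0 yz zB; have z0 := le_trans y0 yz; have B0 := le_trans z0 zB.
have /andP[I0 I1] := levy_integral_increment m_fin y0 yz zB.
rewrite /= -/J in I1; rewrite !phiE//.
set Iz := \int[m]_(u in _) _ in I0 I1 *.
set Iy := \int[m]_(u in _) (expR (- (y * u)) - _ + _) in I0 I1 *.
have zy0 : 0 <= z - y by rewrite subr_ge0.
have -> : b * z + c * z ^+ 2 + Iz - (b * y + c * y ^+ 2 + Iy) =
  b * (z - y) + c * (z + y) * (z - y) + (Iz - Iy) by ring.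
rewrite /L (ger0_norm zy0) (ger0_norm B0).
have -> : (`|b| + c * (2 * B) + (1 + B) * J) * (z - y) =
  `|b| * (z - y) + c * (2 * B) * (z - y) + (z - y) * ((1 + B) * J) by ring.
apply: (le_trans (ler_normD _ _)); apply: lerD; last first.
  by rewrite ger0_norm.
apply: (le_trans (ler_normD _ _)); rewrite !normrM (ger0_norm zy0).
rewrite (ger0_norm c0) (ger0_norm (addr_ge0 z0 y0)) lerD2l.
by rewrite ler_wpM2r// ler_wpM2l//; lra.
Qed.

End branching_mechanism_properties.

(** * Backward Gronwall inequality *)

Lemma lebesgue_itv_lty (R : realType) (a b : R) :
  (@lebesgue_measure R `[a, b]%classic < +oo)%E.
Proof. by rewrite lebesgue_measure_itv/=; case: ifPn; rewrite ?ltry. Qed.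

Section backward_gronwall.
Variable R : realType.
Notation leb := (@lebesgue_measure R).

Lemma continuous_expR_affine (a t : R) :
  continuous (fun q : R => expR (a * (t - q))).
Proof.
move=> q; apply: (@continuous_comp _ _ _ (fun q => a * (t - q)) expR);
  last exact: continuous_expR.
by apply: cvgM; [exact: cvg_cst|apply: cvgB; [exact: cvg_cst|exact: cvg_id]].
Qed.

(** The derivative is left as the chain rule produces it; for nonzero a it equals exp(a (t - q)), so
    the function is an antiderivative of the Gronwall weight. *)
Lemma is_derive_expR_affine (a t q : R) :
  is_derive q (1 : R) (fun q => - (expR (a * (t - q)) / a))
    (- ((expR (a * (t - q)) * (a * (0 - 1))) / a)).
Proof.
have H : is_derive q (1 : R) (fun q => a * (t - q)) (a * (0 - 1)).
  exact: is_deriveZ.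
have := @is_derive1_comp R expR (fun q => a * (t - q)) q _ _ (is_derive_expR _) H.
move=> H'; apply: is_deriveN.
rewrite -[_ / a]mulrC.
have -> : (fun y => expR (a * (t - y)) / a) =
    (fun y => a^-1 * expR (a * (t - y))).
  by apply/funext => y; rewrite mulrC.
exact: is_deriveZ.
Qed.

Lemma Rintegral_expR_affine (a r t : R) : 0 < a -> r <= t ->
  \int[leb]_(q in `[r, t]) expR (a * (t - q)) = (expR (a * (t - r)) - 1) / a.
Proof.
move=> a0; rewrite le_eqVlt => /predU1P[->|rt].
  by rewrite set_itv1 Rintegral_set1 subrr mulr0 expR0 subrr mul0r.
pose F q := - (expR (a * (t - q)) / a).
have cF : continuous F.
  move=> q; apply: differentiable_continuous; apply/derivable1_diffP.
  by case: (is_derive_expR_affine a t q).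
have cf := @continuous_expR_affine (a) t.
rewrite /Rintegral (@continuous_FTC2 _ _ F)//=.
- by rewrite /F subrr mulr0 expR0; ring.
- exact: continuous_subspaceT.
- split.
  + by move=> q _; case: (is_derive_expR_affine a t q).
  + exact/cvg_at_right_filter/cF.
  + exact/cvg_at_left_filter/cF.
- move=> q _; rewrite derive1E.
  rewrite (@derive_val _ _ _ _ _ _ _ (is_derive_expR_affine a t q)).
  by field; rewrite gt_eqF.
Qed.

Variables (t K L M : R) (f : R -> R).
Hypotheses (K0 : 0 <= K) (L0 : 0 < L).
Hypothesis mf : measurable_fun `[0, t] f.
Hypothesis fM : forall r, 0 <= r <= t -> 0 <= f r <= M.
Hypothesis fK : forall r, 0 <= r <= t ->
  f r <= K + L * \int[leb]_(q in `[r, t]) f q.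

(* In the norm sup_r f(r) exp(-2L(t - r)) the integral operator is a
   contraction of ratio 1/2. *)
Lemma backward_gronwall r : 0 <= r <= t ->
  f r <= 2 * K * expR (2 * L * (t - r)).
Proof.
pose g r := f r * expR (- (2 * L * (t - r))).
pose S := [set g r | r in [set r | 0 <= r <= t]].
move=> rt.
have ubS : has_ubound S.
  exists M => _ [q /= qt <-]; have /andP[f0 fm] := fM qt.
  apply: le_trans fm; rewrite /g ler_piMr// expR_le1 oppr_le0.
  apply: mulr_ge0; first by rewrite mulr_ge0// ltW.
  by case/andP: qt => _ qt; rewrite subr_ge0.
have hS : has_sup S by split => //; exists (g r), r.
have fS q : 0 <= q <= t -> f q <= sup S * expR (2 * L * (t - q)).
  move=> qt; have : g q <= sup S by apply: sup_upper_bound => //; exists q.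
  by rewrite /g expRN ler_pdivrMr// expR_gt0.
have S0 : 0 <= sup S.
  apply: (@le_trans _ _ (g r)); last by apply: sup_upper_bound => //; exists r.
  by rewrite mulr_ge0 ?expR_ge0//; case/andP: (fM rt).
have cf := @continuous_expR_affine (2 * L) t.
(* With e = exp(2L(t - q)), the integral term contributes sup S (e - 1) / 2, and K <= K e because e
   >= 1; dividing by e gives the claim. As f is bounded, sup S is finite and its half can be
   absorbed on the left. *)
have S2 : sup S <= K + sup S / 2.
  apply: ge_sup; first by exists (g r), r.
  move=> _ [q /= qt <-]; have /andP[q0 qt'] := qt.
  have tq : 0 <= t - q by rewrite subr_ge0.
  rewrite /g expRN ler_pdivrMr ?expR_gt0//.
  apply: (le_trans (fK qt)).
  have sub : `[q, t] `<=` `[0, t] by apply: subset_itvr; rewrite bnd_simp.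
  have bnd : \int[leb]_(y in `[q, t]) f y <=
      \int[leb]_(y in `[q, t]) (sup S * expR (2 * L * (t - y))).
    apply: le_Rintegral => //.
    - apply: (@bounded_integrable _ _ _ _ _ _ M) => //.
      + exact: lebesgue_itv_lty.
      + exact: measurable_funS mf.
      + move=> y /sub /=; rewrite in_itv/= => yt.
        by have /andP[f0 ?] := fM yt; rewrite ger0_norm.
    - apply: continuous_compact_integrable; first exact: segment_compact.
      apply: continuous_subspaceT => y.
      by apply: cvgM; [exact: cvg_cst|exact: cf].
    - by move=> y /sub /=; rewrite in_itv/= => yt; exact: fS.
  rewrite RintegralZl// in bnd; last first.
    apply: continuous_compact_integrable; first exact: segment_compact.
    exact: continuous_subspaceT.
  rewrite Rintegral_expR_affine// ?mulr_gt0// in bnd.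
  set e := expR _ in bnd *.
  have e1 : 1 <= e by rewrite -expR0 ler_expR mulr_ge0// mulr_ge0// ltW.
  have := ler_wpM2l (ltW L0) bnd.
  have -> : L * (sup S * ((e - 1) / (2 * L))) = sup S * (e - 1) / 2.
    by field; rewrite gt_eqF.
  have Ke : K <= K * e by rewrite ler_peMr.
  set I := \int[_]_(_ in _) _; set J := sup S in S0 *.
  move=> bI; rewrite [(K + _) * _]mulrDl.
  have -> : J / 2 * e = J * (e - 1) / 2 + J / 2 by field.
  lra.
have S2K : sup S <= 2 * K by lra.
by apply: (le_trans (fS _ rt)); rewrite ler_wpM2r// expR_ge0.
Qed.

End backward_gronwall.

(** * Cumulant semigroup *)

Section locally_lipschitz.
Variables (R : realType) (phi : R -> R).
Notation leb := (@lebesgue_measure R).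
Hypothesis phi_lip : forall B, exists2 L, 0 <= L &
  forall y z, 0 <= y <= B -> 0 <= z <= B -> `|phi z - phi y| <= L * `|z - y|.

(** Nothing is known of phi at negative arguments, so it is composed with the projection onto
    [0, |B|], which is 1-Lipschitz. The result is continuous on the whole line and can replace phi
    in measurability and limit arguments. *)
Lemma continuous_extension B : exists2 g : R -> R, continuous g &
  forall z, 0 <= z <= B -> g z = phi z.
Proof.
have [L L0 lip] := phi_lip `|B|.
pose c z := Num.max 0 (Num.min z `|B|).
have c_itv z : 0 <= c z <= `|B|.
  by rewrite /c le_max lexx/= ge_max normr_ge0/= ge_min lexx orbT.
have max_lip (a b : R) : `|Num.max 0 a - Num.max 0 b| <= `|a - b|.
  by case: (leP 0 a) => ?; case: (leP 0 b) => ?;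
    rewrite ?subrr ?normr_ge0// ler_norml; case: (ger0P (a - b)) => ?;
    apply/andP; split; lra.
have min_lip (m a b : R) : `|Num.min a m - Num.min b m| <= `|a - b|.
  case: (leP a m) => ?; case: (leP b m) => ?;
    rewrite ?subrr ?normr_ge0// ler_norml; case: (ger0P (a - b)) => ?;
    by apply/andP; split; lra.
have c_lip z y : `|c z - c y| <= `|z - y|.
  exact: le_trans (max_lip _ _) (min_lip _ _ _).
exists (phi \o c); last first.
  move=> z /andP[z0 zB]; rewrite /= /c (min_idPl _) ?(max_idPr z0)//.
  by rewrite (le_trans zB)// ler_norm.
move=> x; apply/cvgrPdist_lt => e e0; near=> y.
rewrite /= (le_lt_trans (lip _ _ (c_itv y) (c_itv x)))//.
(* L may be zero; L + 1 can be divided by. *)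
rewrite (@le_lt_trans _ _ ((L + 1) * `|x - y|))//.
  have := c_lip x y; have := normr_ge0 (x - y); have := normr_ge0 (c x - c y).
  by nra.
rewrite mulrC -ltr_pdivlMr; last by lra.
near: y; apply: cvgr_dist_lt => //.
by rewrite divr_gt0//; lra.
Unshelve. all: by end_near. Qed.

Lemma bounded_on_itv B : exists2 C, 0 <= C &
  forall z, 0 <= z <= B -> `|phi z| <= C.
Proof.
have [L L0 lip] := phi_lip B.
exists (`|phi 0| + L * `|B|); first by rewrite addr_ge0// mulr_ge0.
move=> z /andP[z0 zB]; have B0 := le_trans z0 zB.
have := lip 0 z; rewrite lexx z0 zB B0 subr0 => /(_ isT isT) H.
have -> : phi z = phi 0 + (phi z - phi 0) by ring.
apply: (le_trans (ler_normD _ _)); rewrite lerD2l (le_trans H)//.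
by rewrite ler_wpM2l// !ger0_norm.
Qed.

Lemma measurable_phi_comp (D : set R) (u : R -> R) B : measurable D ->
  measurable_fun D u -> (forall r, D r -> 0 <= u r <= B) ->
  measurable_fun D (phi \o u).
Proof.
move=> mD mu uB; have [g cg gE] := continuous_extension B.
apply: (@eq_measurable_fun _ _ _ _ _ (g \o u)).
  by move=> r; rewrite inE => Dr /=; rewrite gE// uB.
by apply: measurableT_comp => //; exact: continuous_measurable_fun.
Qed.

Lemma integrable_phi_comp (a b : R) (u : R -> R) B :
  measurable_fun `[a, b] u -> (forall r, a <= r <= b -> 0 <= u r <= B) ->
  leb.-integrable `[a, b] (EFin \o (phi \o u)).
Proof.
move=> mu uB; have [C C0 phiC] := bounded_on_itv B.
apply: (@bounded_integrable _ _ _ _ _ _ C) => //.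
- exact: lebesgue_itv_lty.
- apply: (@measurable_phi_comp _ _ B) => // r /=; rewrite in_itv/=; exact: uB.
- by move=> r /=; rewrite in_itv/= => /uB /phiC.
Qed.

(** The equation exhibits w as a constant minus the indefinite integral of an integrable function.
    Boundedness and measurability on compact intervals follow from this continuity. *)
Lemma cumulant_continuous l w T : 0 <= T -> cumulant_solution phi l w ->
  {within `[0, T], continuous w}.
Proof.
move=> T0 wsol; have [_ iw _] := wsol T T0.
have := parameterized_integral_continuous T0 iw => cI.
apply: (@subspace_eq_continuous _ `[0, T]%classic R
  (fun x => l - \int[leb]_(s in `[0, x]) phi (w s)) w).
  move=> x; rewrite inE/= in_itv/= => /andP[x0 _].
  by have [_ _ ->] := wsol x x0.
by move=> x; apply: cvgB; [exact: cvg_cst|exact: cI].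
Qed.

Lemma cumulant_bounded l w T : 0 <= T -> cumulant_solution phi l w ->
  exists B, forall s, 0 <= s <= T -> 0 <= w s <= B.
Proof.
move=> T0 wsol; have [c _ wc] := EVT_max T0 (cumulant_continuous T0 wsol).
exists (w c) => s sT; have /andP[s0 _] := sT.
by have [-> _ _] := wsol s s0; rewrite wc.
Qed.

Lemma cumulant_measurable l w T : 0 <= T -> cumulant_solution phi l w ->
  measurable_fun (`[0, T] : set R) w.
Proof.
move=> T0 wsol; apply: subspace_continuous_measurable_fun => //.
exact: cumulant_continuous wsol.
Qed.

(** The substitution q -> s - q turns the forward equation on [0, s - r] into a backward equation on
    [r, s], the form needed between two atoms. *)
Lemma cumulant_reversed l w r s : r <= s -> cumulant_solution phi l w ->
  w (s - r) + \int[leb]_(q in `[r, s]) phi (w (s - q)) = l.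
Proof.
move=> rs wsol; have sr0 : 0 <= s - r by rewrite subr_ge0.
have [B wB] := cumulant_bounded sr0 wsol.
have [g cg gE] := continuous_extension B.
have cphi : {within `[0, s - r], continuous (phi \o w)}.
  apply: (@subspace_eq_continuous _ `[0, s - r]%classic R (g \o w) (phi \o w)).
    by move=> q; rewrite inE/= in_itv/= => qsr; rewrite gE// wB.
  have cw := cumulant_continuous sr0 wsol.
  by move=> q; apply: (cvg_comp _ _ (cw q)); exact: cg.
have [_ _ ->] := wsol _ sr0.
suff -> : \int[leb]_(q in `[r, s]) phi (w (s - q)) =
          \int[leb]_(q in `[0, s - r]) phi (w q) by rewrite subrK.
pose F q := s - q.
have dF q : is_derive q (1 : R) F (0 - 1) by exact: is_deriveB.
have F'E : derive1 F = cst (0 - 1).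
  by apply/funext => q; rewrite derive1E (@derive_val _ _ _ _ _ _ _ (dF q)).
have cF : continuous F.
  by move=> q; apply: cvgB; [exact: cvg_cst|exact: cvg_id].
have Fs : F s = 0 by rewrite /F subrr.
have := @integration_by_substitution_decreasing R F (phi \o w) r s rs.
rewrite Fs F'E => H; rewrite /Rintegral H.
- by congr fine; apply: eq_integral => q _ /=; rewrite sub0r opprK mulr1.
- by move=> x y _ _ xy; rewrite /F ltrD2l ltrN2.
- by move=> q _; exact: cst_continuous.
- exact: is_cvg_cst.
- exact: is_cvg_cst.
- split.
  + by move=> q _; case: (dF q).
  + exact/cvg_at_right_filter/cF.
  + exact/cvg_at_left_filter/cF.
- exact: cphi.
Qed.

End locally_lipschitz.

(** * Backward cumulants of purely atomic measures *)

Section cumulant_of_weighted_points.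
Variables (R : realType) (phi : R -> R) (v : R -> R -> R).
Notation leb := (@lebesgue_measure R).
Hypothesis phi_lip : forall B, exists2 L, 0 <= L &
  forall y z, 0 <= y <= B -> 0 <= z <= B -> `|phi z - phi y| <= L * `|z - y|.
Hypothesis phi0 : phi 0 = 0.
Hypothesis v_sol : forall l, 0 <= l -> cumulant_solution phi l (v ^~ l).

(* A list of pairs (s, a), sorted by s, stands for the purely atomic measure
   \sum a \delta_s; between two atoms the cumulant follows v, backwards in
   time, and it jumps by a at s. *)
Fixpoint point_cumulant (l : seq (R * R)) (r : R) : R :=
  if l is p :: l' then
    if r <= p.1 then v (p.1 - r) (p.2 + point_cumulant l' p.1)
    else point_cumulant l' r
  else 0.

Definition weighted_points (t : R) (l : seq (R * R)) :=
  all (fun p => (0 <= p.1 <= t) && (0 <= p.2)) l &&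
  pairwise (fun p q => p.1 <= q.1) l.

Lemma weighted_points_cons t p l : weighted_points t (p :: l) ->
  [/\ 0 <= p.1 <= t, 0 <= p.2, all (fun q => p.1 <= q.1) l
    & weighted_points t l].
Proof.
by rewrite /weighted_points /= => /andP[/andP[/andP[-> ->] ->] /andP[-> ->]].
Qed.

(** Nonnegativity matters as much as the bound: it makes [p.2 + point_cumulant l p.1] an admissible
    initial value for [v]. Here M depends on the list; a uniform bound comes later from Gronwall. *)
Lemma point_cumulant_bounded t l : weighted_points t l ->
  exists M, forall r, 0 <= r <= t -> 0 <= point_cumulant l r <= M.
Proof.
elim: l => [_|p l ih /weighted_points_cons[pt p20 _ /ih[M lM]]] /=.
  by exists 0; rewrite lexx.
have /andP[p10 p1t] := pt.
have c0 : 0 <= p.2 + point_cumulant l p.1.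
  by rewrite addr_ge0//; have /andP[] := lM _ pt.
have [B vB] := cumulant_bounded p10 (v_sol c0).
exists (Num.max B M) => r rt; rewrite le_max; have /andP[r0 _] := rt.
case: ifPn => [rp|_]; last by have /andP[-> ->] := lM _ rt; rewrite orbT.
have /andP[-> -> //] : 0 <= v (p.1 - r) (p.2 + point_cumulant l p.1) <= B.
by apply: vB; rewrite subr_ge0 rp/= gerBl.
Qed.

Lemma measurable_point_cumulant t l : weighted_points t l ->
  measurable_fun (`[0, t] : set R) (point_cumulant l).
Proof.
elim: l => [_|p l ih /[dup] pl /weighted_points_cons[pt p20 _ lt]] /=.
  exact: measurable_cst.
have /andP[p10 p1t] := pt.
have c0 : 0 <= p.2 + point_cumulant l p.1.
  have [M lM] := point_cumulant_bounded lt.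
  by rewrite addr_ge0//; have /andP[] := lM _ pt.
apply: measurable_fun_if => //.
- by apply: measurable_funS measurableT _ _ => //; exact: measurable_fun_ler.
- apply: (@measurable_comp _ _ _ _ _ _ `[0, p.1]%classic (v ^~ _)).
  + exact: measurable_itv.
  + move=> _ [r /= [+ rp] <-]; rewrite !in_itv/= => /andP[r0 _].
    by rewrite subr_ge0 rp gerBl.
  + exact: cumulant_measurable p10 (v_sol c0).
  + by apply: measurable_funS measurableT _ _ => //; exact: measurable_funB.
- by apply: measurable_funS (ih lt) => //; exact: subIsetl.
Qed.

(** Induction on the atoms. On [r, p.1] the reversed cumulant equation returns the initial value,
    which is the weight at p.1 plus the cumulant of the later atoms; the latter is treated by the
    induction hypothesis at p.1. After the last atom the cumulant vanishes and phi 0 = 0. *)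
Lemma point_cumulant_eq t l r : weighted_points t l -> 0 <= r <= t ->
  point_cumulant l r + \int[leb]_(s in `[r, t]) phi (point_cumulant l s) =
  \sum_(p <- l | r <= p.1) p.2.
Proof.
move=> + + ; elim: l r => [|p l ih] r.
  move=> _ _; rewrite big_nil /=.
  under eq_Rintegral do rewrite phi0.
  by rewrite Rintegral_cst// mul0r addr0.
move=> pl rt; have [pt p20 pl' lt] := weighted_points_cons pl.
have [M plM] := point_cumulant_bounded pl.
have mpl := measurable_point_cumulant pl.
have [M' lM] := point_cumulant_bounded lt.
have ml := measurable_point_cumulant lt.
have [/andP[r0 r_t] /andP[p10 p1t]] := (rt, pt).
rewrite big_cons; case: ifPn => [rp|/negbTE rp]; last first.
  rewrite /= rp -ih//; congr (_ + _); apply: eq_Rintegral => s.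
  rewrite inE/= in_itv/= => /andP[rs _].
  by rewrite leNgt (lt_le_trans _ rs)// ltNge rp.
have c0 : 0 <= p.2 + point_cumulant l p.1.
  by rewrite addr_ge0//; have /andP[] := lM _ pt.
have i1 : leb.-integrable `[r, t] (EFin \o (phi \o point_cumulant (p :: l))).
  apply: (integrable_phi_comp phi_lip (B := M)).
    by apply: measurable_funS mpl => //; apply: subset_itvr; rewrite bnd_simp.
  by move=> s /andP[rs st]; apply: plM; rewrite (le_trans r0 rs).
have i2 : leb.-integrable `[p.1, t] (EFin \o (phi \o point_cumulant l)).
  apply: (integrable_phi_comp phi_lip (B := M')).
    by apply: measurable_funS ml => //; apply: subset_itvr; rewrite bnd_simp.
  by move=> s /andP[rs st]; apply: lM; rewrite (le_trans p10 rs).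
have split := @Rintegral_itvB R _ (BLeft r) (BRight t) p.1 i1.
rewrite -[\int[_]_(_ in _) _](subrK
  (\int[leb]_(s in `[r, p.1]) phi (point_cumulant (p :: l) s))).
rewrite split ?bnd_simp//.
(* The cumulants of [p :: l] and [l] agree after p.1 but may differ at p.1 itself, where the jump
   sits; that point is Lebesgue-null. *)
have -> : \int[leb]_(s in `]p.1, t]) (phi \o point_cumulant (p :: l)) s =
          \int[leb]_(s in `[p.1, t]) phi (point_cumulant l s).
  rewrite -Rintegral_itv_obnd_cbnd; last first.
    by apply: integrableS i2 => //; apply: subset_itvr; rewrite bnd_simp.
  apply: eq_Rintegral => s; rewrite inE/= in_itv/= => /andP[ps _].
  by rewrite leNgt ps.
have -> : \int[leb]_(s in `[r, p.1]) phi (point_cumulant (p :: l) s) =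
   \int[leb]_(s in `[r, p.1]) phi (v (p.1 - s) (p.2 + point_cumulant l p.1)).
  by apply: eq_Rintegral => s; rewrite inE/= in_itv/= => /andP[_ ->].
rewrite /= rp addrCA (cumulant_reversed phi_lip rp (v_sol c0)) addrC -addrA.
rewrite ih//; congr (_ + _).
(* By sortedness every atom of [l] lies at or after p.1 >= r, so both conditions on the sums always
   hold. *)
rewrite big_seq_cond [RHS]big_seq_cond; apply: eq_bigl => q.
case: (boolP (q \in l)) => //= ql.
by have pq := allP pl' _ ql; rewrite pq (le_trans rp).
Qed.

End cumulant_of_weighted_points.

(** * Markov property for exponential functionals *)

Section ge0_linear_functionals.
Local Open Scope ereal_scope.

(* The properties of f |-> \int f dm that determine it on nonnegative
   measurable functions from its values on indicators. *)
Definition ge0_linear_functional d (T : measurableType d) (R : realType)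
    (Phi : (T -> \bar R) -> \bar R) :=
  [/\ forall f g, measurable_fun setT f -> measurable_fun setT g ->
        (forall x, 0 <= f x) -> (forall x, 0 <= g x) ->
        Phi (f \+ g) = Phi f + Phi g,
      forall c f, (0 <= c)%R -> measurable_fun setT f ->
        (forall x, 0 <= f x) -> Phi (fun x => c%:E * f x) = c%:E * Phi f
    & forall (f_ : (T -> \bar R)^nat) f, (forall n, measurable_fun setT (f_ n)) ->
        (forall n x, 0 <= f_ n x) ->
        (forall x, {homo f_ ^~ x : n m / (n <= m)%N >-> n <= m}) ->
        (forall x, f_ ^~ x @ \oo --> f x) -> Phi (f_ n) @[n --> \oo] --> Phi f].

Section extension.
Variables (d : measure_display) (T : measurableType d) (R : realType).
Variables Phi Psi : (T -> \bar R) -> \bar R.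
Hypotheses (lPhi : ge0_linear_functional Phi) (lPsi : ge0_linear_functional Psi).
Hypothesis PhiPsi : forall A, measurable A ->
  Phi (fun x => (\1_A x)%:E) = Psi (fun x => (\1_A x)%:E).

Lemma ge0_linear_functional_sum (s : seq R) (A : R -> set T) :
  (forall y, y \in s -> (0 <= y)%R) -> (forall y, measurable (A y)) ->
  Phi (fun x => \sum_(y <- s) (y * \1_(A y) x)%:E) =
  Psi (fun x => \sum_(y <- s) (y * \1_(A y) x)%:E).
Proof.
case: lPhi lPsi => [PD PZ _] [QD QZ _] + mA.
have mi y : measurable_fun [set: T] (fun x => (\1_(A y) x)%:E : \bar R).
  by apply/measurable_EFinP; exact: measurable_indic.
elim: s => [_|y s ih s0].
  under eq_fun do rewrite big_nil.
  (* The zero function is 0 times an indicator, so homogeneity gives the value 0 even if the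
     functional is infinite on that indicator. *)
  have e0 : (fun=> 0) = (fun x => 0%:E * (\1_(@setT T) x)%:E) :> (T -> \bar R).
    by apply/funext => x; rewrite mul0e.
  by rewrite e0 PZ// ?QZ// ?mul0e//; apply/measurable_EFinP; exact: measurable_indic.
have s0' z : z \in s -> (0 <= z)%R by move=> zs; rewrite s0// inE zs orbT.
have y0 : (0 <= y)%R by rewrite s0// mem_head.
under eq_fun do rewrite big_cons.
have m1 : measurable_fun setT (fun x => (y * \1_(A y) x)%:E).
  by apply/measurable_EFinP; apply: measurable_funM => //; exact: measurable_indic.
have m2 : measurable_fun setT (fun x => \sum_(z <- s) (z * \1_(A z) x)%:E).
  apply: emeasurable_sum => z; apply/measurable_EFinP.
  by apply: measurable_funM => //; exact: measurable_indic.
have p1 x : 0 <= (y * \1_(A y) x)%:E by rewrite lee_fin mulr_ge0.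
have p2 x : 0 <= \sum_(z <- s) (z * \1_(A z) x)%:E.
  rewrite big_seq; apply: sume_ge0 => z zs.
  by rewrite lee_fin mulr_ge0// s0'.
rewrite -/((fun x => (y * \1_(A y) x)%:E) \+
  (fun x => \sum_(z <- s) (z * \1_(A z) x)%:E)).
rewrite PD// QD// ih//; congr (_ + _).
under eq_fun do rewrite EFinM.
by rewrite PZ// QZ// PhiPsi.
Qed.

Import HBNNSimple.

(** The functionals agree on simple functions by linearity, and both pass to the limit along simple
    functions increasing to f. *)
Lemma ge0_linear_functional_ext (f : T -> \bar R) :
  measurable_fun setT f -> (forall x, 0 <= f x) -> Phi f = Psi f.
Proof.
move=> mf f0; pose f_ := nnsfun_approx measurableT mf.
have eqn n : Phi (EFin \o f_ n) = Psi (EFin \o f_ n).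
  have -> : EFin \o f_ n = (fun x =>
      \sum_(y <- finmap.enum_fset (fset_set (range (f_ n))))
        (y * \1_(f_ n @^-1` [set y]) x)%:E).
    apply/funext => x /=; rewrite [in LHS]fimfunE -fsumEFin// fsbig_finite//.
  apply: ge0_linear_functional_sum => y.
    by rewrite in_fset_set// inE => -[x _ <-].
  exact: measurable_sfunP.
have [[_ _ cP] [_ _ cQ]] := (lPhi, lPsi).
have mf_ n : measurable_fun setT (EFin \o f_ n) by exact/measurable_EFinP.
have f_0 n x : 0 <= (EFin \o f_ n) x by rewrite lee_fin.
have nd x : {homo (fun n => (EFin \o f_ n) x) : n m / (n <= m)%N >-> n <= m}.
  by move=> n m nm; rewrite lee_fin; exact/lefP/nd_nnsfun_approx.
have cv x : (EFin \o f_ n) x @[n --> \oo] --> f x.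
  by apply: (cvg_nnsfun_approx measurableT mf) => //.
apply: (@cvg_unique _ (@ereal_hausdorff R) (Phi (EFin \o f_ n) @[n --> \oo])).
  exact: cP.
have -> : (fun n => Phi (EFin \o f_ n)) = (fun n => Psi (EFin \o f_ n)).
  exact/funext.
exact: cQ.
Qed.

End extension.

(** Used in two ways: with weight 1 and [Y] the state at a later time, and with an exponential
    weight and [Y] the identity onto the past sigma-algebra. *)
Lemma ge0_linear_functional_weighted d d' (S : measurableType d)
    (T : measurableType d') (R : realType) (mu : {measure set S -> \bar R})
    (A : set S) (Y : S -> T) (g : S -> R) : measurable A ->
  measurable_fun setT Y -> measurable_fun setT g -> (forall x, 0 <= g x)%R ->
  ge0_linear_functional (fun f => \int[mu]_(x in A) (f (Y x) * (g x)%:E)).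
Proof.
move=> mA mY mg g0.
have mfY (f : T -> \bar R) : measurable_fun setT f ->
    measurable_fun A (fun x => f (Y x) * (g x)%:E).
  move=> mf; apply: (measurable_funS measurableT) => //.
  apply: emeasurable_funM; first exact: measurableT_comp.
  exact/measurable_EFinP.
split.
- move=> f h mf mh f0 h0; rewrite -ge0_integralD//; first 1 last.
  + by move=> x _; rewrite mule_ge0// lee_fin.
  + exact: mfY.
  + by move=> x _; rewrite mule_ge0// lee_fin.
  + exact: mfY.
  by apply: eq_integral => x _ /=; rewrite ge0_muleDl.
- move=> c f c0 mf f0; rewrite -ge0_integralZl//; first 1 last.
  + exact: mfY.
  + by move=> x _; rewrite mule_ge0// lee_fin.
  by apply: eq_integral => x _ /=; rewrite muleA.
- move=> f_ f mf_ f_0 nd cv.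
  have := @cvg_monotone_convergence _ _ _ mu A mA
    (fun n x => f_ n (Y x) * (g x)%:E).
  have -> : \int[mu]_(x in A) limn (fun n => f_ n (Y x) * (g x)%:E) =
      \int[mu]_(x in A) (f (Y x) * (g x)%:E).
    apply: eq_integral => x _; apply/cvg_lim => //.
    by apply: cvgeZr => //; exact: cv.
  apply.
  + by move=> n; exact: mfY.
  + by move=> n x _; rewrite mule_ge0// lee_fin.
  + by move=> x _ n m nm; apply: lee_wpmul2r; [rewrite lee_fin|exact: nd].
Qed.

(** This is the kernel side of the Markov property, as a functional of the test function. *)
Lemma ge0_linear_functional_kernel d d' (S : measurableType d)
    (T : measurableType d') (R : realType) (mu : {measure set S -> \bar R})
    (A : set S) (k : S -> {measure set T -> \bar R}) : measurable A ->
  (forall U, measurable U -> measurable_fun setT (k ^~ U)) ->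
  ge0_linear_functional (fun f => \int[mu]_(x in A) \int[k x]_y f y).
Proof.
move=> mA mk.
have mfk (f : T -> \bar R) : measurable_fun setT f -> (forall y, 0 <= f y) ->
    measurable_fun A (fun x => \int[k x]_y f y).
  move=> mf f0; apply: (measurable_funS measurableT) => //.
  exact: measurable_fun_integral_kernel.
split.
- move=> f h mf mh f0 h0; rewrite -ge0_integralD//; first 1 last.
  + by move=> x _; apply: integral_ge0.
  + exact: mfk.
  + by move=> x _; apply: integral_ge0.
  + exact: mfk.
  by apply: eq_integral => x _ /=; rewrite -ge0_integralD.
- move=> c f c0 mf f0; rewrite -ge0_integralZl//; first 1 last.
  + exact: mfk.
  + by move=> x _; apply: integral_ge0.
  by apply: eq_integral => x _ /=; rewrite -ge0_integralZl.
- move=> f_ f mf_ f_0 nd cv.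
  have := @cvg_monotone_convergence _ _ _ mu A mA
    (fun n x => \int[k x]_y f_ n y).
  have -> : \int[mu]_(x in A) limn (fun n => \int[k x]_y f_ n y) =
      \int[mu]_(x in A) \int[k x]_y f y.
    apply: eq_integral => x _; apply/cvg_lim => //.
    have := @cvg_monotone_convergence _ _ _ (k x) setT measurableT f_ mf_.
    have -> : (fun y => limn (f_ ^~ y)) = f.
      by apply/funext => y; apply/cvg_lim => //; exact: cv.
    by apply => // y _ n m nm; exact: nd.
  apply.
  + by move=> n; exact: mfk.
  + by move=> n x _; apply: integral_ge0.
  + by move=> x _ n m nm; apply: ge0_le_integral => // y _; exact: nd.
Qed.

End ge0_linear_functionals.

(** * Markov property tested against exponentials *)

Section markov_property.
Variables (R : realType) (phi : R -> R).
Variables (Q : R -> R.-pker (measurableTypeR R) ~> (measurableTypeR R)).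
Variables (d : measure_display) (Omega : measurableType d).
Variables (P : probability Omega R) (X : R -> Omega -> measurableTypeR R).
Variables (r x : R) (v : R -> R -> R).
Hypothesis Q_laplace : forall t y l, 0 <= t -> 0 <= y -> 0 <= l ->
  (\int[Q t y]_(z in `[0%R, +oo[) (expR (- (l * z)))%:E
    = (expR (- (y * v t l)))%:E)%E.
Hypothesis X_markov : cadlag_markov_process Q P X r x.

(** The generators of [natural_filtration] are isolated so that [past s] becomes a measurable type,
    and adaptedness becomes [measurable_fun] on it. *)
Definition past_events (s : R) : set (set Omega) :=
  [set A | exists u B, [/\ r <= u, u <= s, measurable B & A = X u @^-1` B]].

Notation past s := (g_sigma_algebraType (past_events s)).

Lemma past_measurable s (A : set Omega) :
  <<s past_events s >> A -> measurable A.
Proof.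
have [mX _ _ _ _] := X_markov.
apply: smallest_sub => [|_ [u [B [ru us mB ->]]]].
  exact: sigma_algebra_measurable.
by rewrite -[_ @^-1` _]setTI; exact: mX.
Qed.

Lemma past_monotone s s' (Z : Omega -> R) : s <= s' ->
  measurable_fun setT (Z : past s -> R) ->
  measurable_fun setT (Z : past s' -> R).
Proof.
move=> ss' mZ _ B mB; have := mZ measurableT B mB.
apply: sub_sigma_algebra2 => _ [u [C [ru us mC ->]]].
by exists u, C; split=> //; exact: le_trans us ss'.
Qed.

Lemma past_state s u : r <= u -> u <= s ->
  measurable_fun setT (X u : past s -> R).
Proof.
move=> ru us _ B mB; rewrite setTI; apply: sub_gen_smallest.
by exists u, B.
Qed.

(** The Markov hypothesis is the case of indicators of B; both sides are functionals of the test
    function, which may therefore be an exponential. *)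
Lemma markov_laplace_set q s l (A : set Omega) : r <= q -> q <= s -> 0 <= l ->
  <<s past_events q >> A ->
  (\int[P]_(w in A) (expR (- (l * X s w)))%:E =
   \int[P]_(w in A) (expR (- (v (s - q) l * X q w)))%:E)%E.
Proof.
have [mX X0 _ _ XQ] := X_markov.
move=> rq qs l0 FA; have rs := le_trans rq qs.
have mA := past_measurable FA.
(* The exponential is cut off outside [0, +oo) because the Laplace transform of the kernel is given
   as an integral over that half-line. The paths are nonnegative and do not see the cut-off. *)
pose f : measurableTypeR R -> \bar R :=
  (fun y => (expR (- (l * y)))%:E) \_ `[0, +oo[.
have mf : measurable_fun setT f.
  apply/(measurable_restrictT _ _).1 => //.
  apply/measurable_EFinP; apply: measurable_funTS.
  apply: (@measurableT_comp _ _ _ _ _ _ expR) => //=.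
  by apply: measurableT_comp => //; exact: measurable_funM.
have f0 y : (0 <= f y)%E by rewrite /f patchE; case: ifP.
have fX w : f (X s w) = (expR (- (l * X s w)))%:E.
  by rewrite /f patchE mem_set//= in_itv/= X0.
have mk U : measurable U ->
    measurable_fun [set: Omega] ((fun w => Q (s - q) (X q w)) ^~ U).
  move=> mU; apply: (@measurableT_comp _ _ _ _ _ _ (Q (s - q) ^~ U)).
    exact: measurable_kernel.
  exact: mX.
have := @ge0_linear_functional_ext _ _ _ _ _
  (@ge0_linear_functional_weighted _ _ _ _ _ P A (X s) (cst 1) mA (mX s rs)
    (measurable_cst _) (fun=> ler01))
  (@ge0_linear_functional_kernel _ _ _ _ _ P A (fun w => Q (s - q) (X q w)) mA mk)
  _ f mf f0.
have sq : 0 <= s - q by rewrite subr_ge0.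
have -> : (\int[P]_(w in A) (f (X s w) * (cst 1 w)%:E) =
    \int[P]_(w in A) (expR (- (l * X s w)))%:E)%E.
  by apply: eq_integral => w _; rewrite fX mule1.
have -> : (\int[P]_(w in A) \int[Q (s - q) (X q w)]_y f y =
    \int[P]_(w in A) (expR (- (v (s - q) l * X q w)))%:E)%E.
  apply: eq_integral => w _; rewrite -integral_mkcond Q_laplace//.
    by rewrite mulrC.
  exact: X0.
apply => B mB.
under eq_integral do rewrite mule1.
under [RHS]eq_integral do rewrite integral_indic// setIT.
rewrite -XQ//.
have mXB : measurable (X s @^-1` B) by rewrite -[_ @^-1` _]setTI; exact: mX.
by rewrite setIC -integral_indic.
Qed.

(** The second extension, now in the past variable: from indicators of events of the past to
    nonnegative adapted weights Z. *)
Lemma markov_laplace q s l (Z : Omega -> R) : r <= q -> q <= s -> 0 <= l ->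
  measurable_fun setT (Z : past q -> R) -> (forall w, 0 <= Z w) ->
  (\int[P]_w (Z w * expR (- (l * X s w)))%:E =
   \int[P]_w (Z w * expR (- (v (s - q) l * X q w)))%:E)%E.
Proof.
have [mX X0 _ _ _] := X_markov.
move=> rq qs l0 mZ Z0; have rs := le_trans rq qs.
have mid : measurable_fun setT (id : Omega -> past q).
  by move=> _ B FB; rewrite setTI; exact: (@past_measurable q B FB).
have me c u : r <= u -> measurable_fun setT (fun w => expR (- (c * X u w))).
  move=> ru; apply: (@measurableT_comp _ _ _ _ _ _ expR) => //=.
  apply: measurableT_comp => //; apply: measurable_funM => //.
  exact: mX.
have wf c u (ru : r <= u) := @ge0_linear_functional_weighted _ _ _ _ _ P setT
  (id : Omega -> past q) (fun w => expR (- (c * X u w))) measurableT mid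
  (me c u ru) (fun w => expR_ge0 _).
have := ge0_linear_functional_ext (wf l s rs) (wf (v (s - q) l) q rq) _
  ((measurable_EFinP _ _).2 mZ).
apply => [A FA|w]; last by rewrite lee_fin.
have H := markov_laplace_set rq qs l0 FA.
have mA := past_measurable FA.
have E c u : (\int[P]_w ((\1_A (id w : past q))%:E * (expR (- (c * X u w)))%:E) =
    \int[P]_(w in A) (expR (- (c * X u w)))%:E)%E.
  rewrite [RHS]integral_mkcond; apply: eq_integral => w _.
  by rewrite patchE indicE; case: ifP => _; rewrite ?mul1e ?mul0e.
by rewrite !E.
Qed.

End markov_property.

(** * Laplace functionals of purely atomic measures *)

Section laplace_of_weighted_points.
Variables (R : realType) (phi : R -> R).
Variables (Q : R -> R.-pker (measurableTypeR R) ~> (measurableTypeR R)).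
Variables (d : measure_display) (Omega : measurableType d).
Variables (P : probability Omega R) (X : R -> Omega -> measurableTypeR R).
Variables (r x : R) (v : R -> R -> R).
Hypothesis v_sol : forall l, 0 <= l -> cumulant_solution phi l (v ^~ l).
Hypothesis Q_laplace : forall t y l, 0 <= t -> 0 <= y -> 0 <= l ->
  (\int[Q t y]_(z in `[0%R, +oo[) (expR (- (l * z)))%:E
    = (expR (- (y * v t l)))%:E)%E.
Hypothesis X_markov : cadlag_markov_process Q P X r x.

Notation past s := (g_sigma_algebraType (past_events X r s)).

(** The arbitrary weight Z makes the induction work: the factor of the first atom is absorbed into
    Z, which stays adapted at time p.1. The induction hypothesis then leaves X at p.1 with
    coefficient [p.2 + point_cumulant l p.1], and one Markov step from q to p.1 concludes. *)
Lemma markov_points t l q (Z : Omega -> R) : weighted_points t l ->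
  r <= q -> all (fun p => q <= p.1) l ->
  measurable_fun setT (Z : past q -> R) -> (forall w, 0 <= Z w) ->
  (\int[P]_w (Z w * expR (- \sum_(p <- l) p.2 * X p.1 w))%:E =
   \int[P]_w (Z w * expR (- (point_cumulant v l q * X q w)))%:E)%E.
Proof.
elim: l q Z => [|p l ih] q Z.
  move=> _ _ _ _ _ /=.
  by apply: eq_integral => w _; rewrite big_nil mul0r.
move=> /[dup] pl /weighted_points_cons[pt p20 pl' lt] rq /= /andP[qp _] mZ Z0.
have rp := le_trans rq qp.
have c0 : 0 <= p.2 + point_cumulant v l p.1.
  have [M lM] := point_cumulant_bounded v_sol lt.
  by rewrite addr_ge0//; have /andP[] := lM _ pt.
pose Z' w := Z w * expR (- (p.2 * X p.1 w)).
have mZ' : measurable_fun setT (Z' : past p.1 -> R).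
  apply: measurable_funM; first exact: past_monotone mZ.
  apply: (@measurableT_comp _ _ _ _ _ _ expR) => //=.
  apply: measurableT_comp => //; apply: measurable_funM => //.
  exact: past_state.
transitivity (\int[P]_w (Z' w * expR (- \sum_(p <- l) p.2 * X p.1 w))%:E)%E.
  apply: eq_integral => w _.
  by rewrite big_cons opprD expRD mulrA.
have Z'0 w : 0 <= Z' w by rewrite mulr_ge0// expR_ge0.
rewrite (ih p.1 Z' lt rp pl' mZ' Z'0).
rewrite qp -(markov_laplace Q_laplace X_markov rq qp c0 mZ Z0).
apply: eq_integral => w _.
by rewrite -mulrA -expRD -opprD -mulrDl.
Qed.

(** Atoms before r drop out of the sum and of the cumulant alike. Once one atom is at or after r, so
    are all later ones, and [markov_points] applies at q = r with Z = 1. *)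
Lemma laplace_points t l : weighted_points t l ->
  (\int[P]_w (expR (- \sum_(p <- l | r <= p.1) p.2 * X p.1 w))%:E =
   (expR (- (x * point_cumulant v l r)))%:E)%E.
Proof.
have [mX _ _ Xr _] := X_markov.
elim: l => [|p l ih] pl /=.
  under eq_integral do rewrite big_nil oppr0 expR0.
  by rewrite integral_cst// mul1e mulr0 oppr0 expR0; exact: probability_setT.
have [pt p20 pl' lt] := weighted_points_cons pl.
case: ifPn => [rp|rp]; last first.
  rewrite -ih//; apply: eq_integral => w _.
  by rewrite big_cons (negbTE rp).
have al : all (fun q => r <= q.1) (p :: l).
  by rewrite /= rp; apply: sub_all pl' => q; exact: le_trans.
transitivity (\int[P]_w (1 * expR (- \sum_(p <- (p :: l)) p.2 * X p.1 w))%:E)%E.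
  apply: eq_integral => w _; rewrite mul1r; congr (expR (- _))%:E.
  rewrite big_seq_cond [RHS]big_seq_cond; apply: eq_bigl => q.
  by case: (boolP (q \in p :: l)) => //= /(allP al) ->.
rewrite (markov_points (Z := cst 1) pl (lexx r) al (measurable_cst _) (fun=> ler01)).
rewrite /= rp; set c := v _ _.
have mXx : measurable [set w | X r w = x].
  have := mX r (lexx r) measurableT _ (measurable_set1 x).
  by rewrite setTI.
transitivity (\int[P]_w (cst (expR (- (x * c)))%:E w))%E; last first.
  rewrite integral_cst// -[RHS]mule1; congr (_ * _)%E; exact: probability_setT.
(* The initial condition X r = x holds only almost surely. *)
apply: ae_eq_integral => //.
  apply/measurable_EFinP; apply: measurable_funM => //.
  apply: (@measurableT_comp _ _ _ _ _ _ expR) => //=.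
  by apply: measurableT_comp => //; apply: measurable_funM => //; exact: mX.
exists (~` [set w | X r w = x]); split.
- exact: measurableC.
- by have := probability_setC P mXx; rewrite Xr subee.
- move=> w /= + Xw; apply => _; rewrite mul1r.
  by rewrite Xw mulrC.
Qed.

End laplace_of_weighted_points.

(** * Discretization of the occupation measure *)

(** Near each point the path is bounded on the right by right continuity and on the left by the left
    limit. Compactness, in its near-covering form with the bound as parameter tending to infinity,
    makes these local bounds uniform. *)
Lemma cadlag_bounded (R : realType) (f : R -> R) (r t : R) :
  cadlag_from r f -> exists C, forall s, r <= s <= t -> `|f s| <= C.
Proof.
move=> [rc ll].
have /compact_near_coveringP cov := @segment_compact R r t.
have [|C [_ Cf]] := cov R (pinfty_nbhs R) (fun i y => r <= y -> `|f y| <= i) _.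
- move=> s; rewrite /= in_itv/= => /andP[rs _].
  have [M1 nM1] : exists M, \forall y \near s, s < y -> `|f y| <= M.
    have near1 : \forall y \near s, s < y -> `|f s - f y| < 1.
      by have /cvgrPdist_lt/(_ _ ltr01) := rc s rs.
    exists (`|f s| + 1); apply: filterS near1 => y h sy.
    have := h sy; rewrite distrC => /ltW h1.
    by have := ler_normD (f y - f s) (f s); rewrite subrK; lra.
  have [M2 nM2] : exists M, \forall y \near s, r <= y -> y < s -> `|f y| <= M.
    move: rs; rewrite le_eqVlt => /predU1P[<-|rs].
      (* At s = r there is no y with r <= y < s, so any bound will do. *)
      by exists 0; apply: filterE => y ry; rewrite ltNge ry.
    have /cvg_ex[l fl] := ll s rs.
    have near1 : \forall y \near s, y < s -> `|l - f y| < 1.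
      by have /cvgrPdist_lt/(_ _ ltr01) := fl.
    exists (`|l| + 1); apply: filterS near1 => y h _ ys.
    have := h ys; rewrite distrC => /ltW h1.
    by have := ler_normD (f y - l) l; rewrite subrK; lra.
  pose M := Num.max `|f s| (Num.max M1 M2).
  exists ([set y | (s < y -> `|f y| <= M1) /\ (r <= y -> y < s -> `|f y| <= M2)],
    [set i | M <= i]).
    split => /=; first exact: filterI.
    by exists M; split; [exact: num_real|move=> i /ltW].
  move=> [y i] /= [[h1 h2]]; rewrite /M !ge_max => /and3P[hs hM1 hM2] ry.
  case: (ltgtP y s) => ys.
  + exact: le_trans (h2 ry ys) hM2.
  + exact: le_trans (h1 ys) hM1.
  + by rewrite ys.
(* The covering property holds for parameters strictly above C. *)
- exists (C + 1) => s /andP[rs st].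
  by apply: (Cf (C + 1)); rewrite /= ?in_itv/= ?rs ?ltrDl.
Qed.

Section rounding.
Variables (R : realType) (t : R).
Hypothesis t0 : 0 <= t.

(* Rounding is strictly to the right, except at t, so that right-continuous
   functions are recovered in the limit. *)
Definition node n j : R := Num.min (j.+1%:R / n.+1%:R) t.
Definition cell_index n (s : R) := Num.truncn (n.+1%:R * s).
Definition round_right n (s : R) := node n (cell_index n s).
Definition cell n j : set R := `[j%:R / n.+1%:R, j.+1%:R / n.+1%:R[.

Lemma node_itv n j : 0 <= node n j <= t.
Proof. by rewrite /node ge_min lexx orbT andbT le_min t0 divr_ge0. Qed.

Lemma node_le n i j : (i <= j)%N -> node n i <= node n j.
Proof.
move=> ij; rewrite /node le_min !ge_min lexx orbT andbT.
by rewrite ler_pM2r ?invr_gt0// ler_nat ltnS ij.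
Qed.

Lemma mem_cell n j s : 0 <= s -> (s \in cell n j) = (cell_index n s == j).
Proof.
move=> s0; rewrite /cell_index; set k := Num.truncn _.
have /andP[ks sk] : (k%:R : R) <= n.+1%:R * s < k.+1%:R.
  by apply: Num.Theory.truncn_itv; rewrite mulr_ge0.
apply/idP/eqP; last first.
  move=> <-; rewrite /cell inE/= in_itv/= ler_pdivrMr// ltr_pdivlMr//.
  by rewrite mulrC ks.
rewrite /cell inE/= in_itv/= ler_pdivrMr// ltr_pdivlMr// mulrC => /andP[js sj].
have := le_lt_trans ks sj; have := le_lt_trans js sk.
by rewrite !ltr_nat !ltnS => jk kj; apply/eqP; rewrite eqn_leq jk kj.
Qed.

Lemma round_right_ge n s : 0 <= s <= t -> s <= round_right n s.
Proof.
move=> /andP[s0 st]; rewrite /round_right /node /cell_index le_min st andbT.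
have /andP[_ /ltW] := Num.Theory.truncn_itv (mulr_ge0 (ler0n R n.+1) s0).
by rewrite ler_pdivlMr// [s * _]mulrC.
Qed.

Lemma round_right_gt n s : 0 <= s < t -> s < round_right n s.
Proof.
move=> /andP[s0 st]; rewrite /round_right /node /cell_index lt_min st andbT.
have /andP[_] := Num.Theory.truncn_itv (mulr_ge0 (ler0n R n.+1) s0).
by rewrite ltr_pdivlMr// [s * _]mulrC.
Qed.

Lemma round_right_le n s : 0 <= s -> round_right n s <= s + n.+1%:R^-1.
Proof.
move=> s0; rewrite /round_right /node /cell_index ge_min; apply/orP; left.
have /andP[+ _] := Num.Theory.truncn_itv (mulr_ge0 (ler0n R n.+1) s0).
by rewrite -[X in X / _]natr1 mulrDl mul1r lerD2r ler_pdivrMr// [s * _]mulrC.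
Qed.

Lemma round_right_cvg s : 0 <= s <= t -> round_right n s @[n --> \oo] --> s.
Proof.
move=> st; have /andP[s0 _] := st.
apply: (@squeeze_cvgr _ _ _ _ (cst s) (fun n => s + n.+1%:R^-1)).
- by apply: nearW => n; rewrite round_right_ge// round_right_le.
- exact: cvg_cst.
- rewrite -[X in _ --> X]addr0; apply: cvgD; first exact: cvg_cst.
  exact: cvg_harmonic.
Qed.

(** If r <= s < t, the rounded points tend to s strictly from the right, so right continuity
    suffices; at s = t rounding leaves s fixed. If s < r, the rounded points are eventually below r
    and both sides are 0. *)
Lemma round_right_from r (g : R -> R) s : 0 <= r ->
  (forall q, r <= q -> g x @[x --> q^'+] --> g q) -> 0 <= s <= t ->
  (if r <= round_right n s then g (round_right n s) else 0) @[n --> \oo] -->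
  (if r <= s then g s else 0).
Proof.
move=> r0 gr st; have /andP[s0 s_t] := st; have cvs := round_right_cvg st.
case: (leP r s) => [rs|sr].
  have -> : (fun n => if r <= round_right n s then g (round_right n s) else 0) =
      (fun n => g (round_right n s)).
    by apply/funext => n; rewrite (le_trans rs (round_right_ge n st)).
  move: s_t; rewrite le_eqVlt => /predU1P[sE|s_lt_t].
    have -> : (fun n => g (round_right n s)) = cst (g s).
      apply/funext => n /=; congr g; apply/eqP.
      rewrite eq_le round_right_ge// andbT sE.
      by have /andP[] := node_itv n (cell_index n t).
    exact: cvg_cst.
  apply: (cvg_comp (fun n => round_right n s) g _ (gr s rs)).
  move=> A; rewrite /at_right /within /= => nA.
  have nAr : \forall n \near \oo, s < round_right n s -> A (round_right n s).
    exact: cvs _ nA.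
  apply: (@filterS _ \oo _ _ _ _ nAr) => n; apply.
  by apply: round_right_gt; rewrite s0.
apply: (@cvg_near_cst); near=> n; rewrite leNgt.
have -> // : round_right n s < r.
near: n; exact: (cvgr_lt _ cvs).
Unshelve. all: by end_near. Qed.

End rounding.

(** * Convergence of the discretized measures *)

Section discretized_measure.
Variables (R : realType) (t : R).
Variable mu : {finite_measure set (measurableTypeR R) -> \bar R}.
Variables (lam : R -> R) (M : R).
Hypothesis t0 : 0 <= t.
Hypothesis mlam : measurable_fun (`[0, t] : set R) lam.
Hypothesis lamM : forall s, 0 <= s <= t -> 0 <= lam s <= M.

Let D : set (measurableTypeR R) := `[0, t].

Let mD : measurable D. Proof. exact: measurable_itv. Qed.

Let muD : (mu D < +oo)%E.
Proof. by rewrite ltey_eq fin_num_measure. Qed.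

Let lam_norm s : D s -> `|lam s| <= M.
Proof.
by rewrite /D /= in_itv/= => /lamM/andP[l0 lM]; rewrite ger0_norm.
Qed.

(** The density [lam] is integrated at the original points and enters the weight; only the path is
    evaluated at a node. Hence [lam] need only be Borel. *)
Definition point_weight n j :=
  \int[mu]_(s in (`[0, t] : set R)) (lam s * \1_(cell n j : set R) s).

(** The successor includes the cell that contains t, so the cells cover [0, t]. *)
Definition grid_points n :=
  [seq (node t n j, point_weight n j) | j <- iota 0 (cell_index n t).+1].

Lemma grid_points_weighted n : weighted_points t (grid_points n).
Proof.
apply/andP; split.
  apply/allP => _ /mapP[j _ ->] /=; rewrite node_itv//=.
  apply: Rintegral_ge0 => s; rewrite /= in_itv/= => /lamM/andP[l0 _].
  by rewrite mulr_ge0.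
rewrite pairwise_map; have := iota_sorted 0 (cell_index n t).+1.
rewrite (sorted_pairwise leq_trans); apply: sub_pairwise => i j /=.
exact: node_le.
Qed.

Lemma round_right_step n (G : R -> R) s : 0 <= s <= t ->
  G (round_right t n s) =
  \sum_(j <- iota 0 (cell_index n t).+1) G (node t n j) * \1_(cell n j : set R) s.
Proof.
move=> /andP[s0 st].
have cs : cell_index n s \in iota 0 (cell_index n t).+1.
  rewrite mem_iota/= add0n ltnS; apply: Num.Theory.le_truncn.
  by rewrite ler_wpM2l.
rewrite (bigD1_seq _ cs (iota_uniq _ _))/= indicE mem_cell// eqxx mulr1.
rewrite big1 ?addr0// => j jn.
by rewrite indicE mem_cell// eq_sym (negbTE jn) mulr0.
Qed.

Let measurable_cell n j : measurable_fun D (\1_(cell n j : set R) : R -> R).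
Proof.
by apply: measurable_funTS; apply: measurable_indic; exact: measurable_itv.
Qed.

(** G is arbitrary: after rounding it is a finite combination of indicators of cells. *)
Lemma measurable_round_right n (G : R -> R) :
  measurable_fun (`[0, t] : set R) (fun s => G (round_right t n s)).
Proof.
apply: (eq_measurable_fun (fun s =>
  \sum_(j <- iota 0 (cell_index n t).+1) G (node t n j) * \1_(cell n j : set R) s)).
  by move=> s; rewrite inE/= in_itv/= => /round_right_step ->.
apply: measurable_sum => j; apply: measurable_funM => //.
exact: measurable_cell.
Qed.

(** The atomic sum becomes an integral against the fixed measure [mu], so that letting n grow only
    changes the integrand. *)
Lemma grid_points_sum n (G : R -> R) :
  \sum_(p <- grid_points n) p.2 * G p.1 =
  \int[mu]_(s in (`[0, t] : set R)) (lam s * G (round_right t n s)).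
Proof.
have int1 j : mu.-integrable D (EFin \o (fun s => lam s * \1_(cell n j : set R) s)).
  apply: (@bounded_integrable _ _ _ _ _ _ M) => //.
    by apply: measurable_funM => //; exact: measurable_cell.
  move=> s /lam_norm lM; rewrite indicE; case: (_ \in _); first by rewrite mulr1.
  by rewrite mulr0 normr0 (le_trans _ lM).
have intG j : mu.-integrable D
    (EFin \o (fun s => G (node t n j) * (lam s * \1_(cell n j : set R) s))).
  rewrite (_ : _ \o _ = fun s => ((G (node t n j))%:E *
    (EFin \o (fun s => lam s * \1_(cell n j : set R) s)%R) s)%E)//.
  exact: integrableZl.
rewrite big_map /=.
transitivity (\sum_(j <- iota 0 (cell_index n t).+1)
    \int[mu]_(s in D) (G (node t n j) * (lam s * \1_(cell n j : set R) s))).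
  by apply: eq_bigr => j _; rewrite RintegralZl// mulrC.
rewrite /Rintegral sum_fine; last first.
  by move=> j _; apply: integrable_fin_num => //; exact: intG.
rewrite -integral_sum//; congr fine; apply: eq_integral => s.
rewrite inE /D /= in_itv/= => st; rewrite (round_right_step n G st).
rewrite sumEFin mulr_sumr; congr (_%:E); apply: eq_bigr => j _.
by rewrite mulrCA.
Qed.

(** The restriction to atoms at or after r is moved into the integrand as a cut-off of g. Then
    [round_right_from] gives pointwise convergence, and M C bounds the integrands. *)
Lemma grid_points_cvg (r C : R) (g : R -> R) : 0 <= r -> 0 <= C ->
  (forall s, r <= s -> g q @[q --> s^'+] --> g s) ->
  (forall s, r <= s <= t -> `|g s| <= C) ->
  \sum_(p <- grid_points n | r <= p.1) p.2 * g p.1 @[n --> \oo] -->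
  \int[mu]_(s in (`[r, t] : set R)) (lam s * g s).
Proof.
move=> r0 C0 gr gC; pose G (s : R) := if r <= s then g s else 0.
have -> : (fun n => \sum_(p <- grid_points n | r <= p.1) p.2 * g p.1) =
    (fun n => \int[mu]_(s in (`[0, t] : set R)) (lam s * G (round_right t n s))).
  apply/funext => n; rewrite -grid_points_sum big_mkcond; apply: eq_bigr => p _.
  by rewrite /G; case: ifP; rewrite ?mulr0.
have -> : \int[mu]_(s in (`[r, t] : set R)) (lam s * g s) =
    \int[mu]_(s in (`[0, t] : set R)) (lam s * G s).
  have -> : `[r, t]%classic = `[0, t]%classic `&` `[r, +oo[%classic :> set R.
    apply/seteqP; split => s /=; rewrite !in_itv/= ?andbT.
      by move=> /andP[rs ->]; rewrite rs (le_trans r0).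
    by move=> [/andP[_ ->] ->].
  rewrite Rintegral_mkcondr; apply: eq_Rintegral => s _.
  rewrite patchE /G mem_setE in_itv/= andbT.
  by case: ifP => _; rewrite ?mulr0.
apply: (@bounded_convergence _ _ _ _ _ _ _ (M * C)) => //.
- by move=> n; apply: measurable_funM => //; exact: measurable_round_right.
- move=> n s Ds; have := lam_norm Ds; move: Ds.
  rewrite /D /= in_itv/= => st lM; rewrite normrM.
  have /andP[_ rt] := node_itv t0 n (cell_index n s).
  have M0 : 0 <= M by exact: le_trans lM.
  rewrite /G; case: ifPn => rs; last first.
    by rewrite normr0 mulr0 mulr_ge0.
  by rewrite ler_pM// gC// rs.
- move=> s; rewrite /= in_itv/= => st; apply: cvgM; first exact: cvg_cst.
  exact: round_right_from.
Qed.

End discretized_measure.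

(** * Passage to the limit *)

Section weighted_occupation_time.
Variables (R : realType) (phi : R -> R).
Variables (Q : R -> R.-pker (measurableTypeR R) ~> (measurableTypeR R)).
Variables (d : measure_display) (Omega : measurableType d).
Variables (P : R -> R -> probability Omega R).
Variables (X : R -> Omega -> measurableTypeR R) (v : R -> R -> R).
Variables (t : R) (mu : {finite_measure set (measurableTypeR R) -> \bar R}).
Variables (lam : R -> R) (M : R).
Notation leb := (@lebesgue_measure R).
Hypothesis phi_bm : branching_mechanism phi.
Hypothesis v_sol : forall l, 0 <= l -> cumulant_solution phi l (v ^~ l).
Hypothesis Q_laplace : forall t y l, 0 <= t -> 0 <= y -> 0 <= l ->
  (\int[Q t y]_(z in `[0%R, +oo[) (expR (- (l * z)))%:E
    = (expR (- (y * v t l)))%:E)%E.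
Hypothesis X_markov : forall r x, 0 <= r -> 0 <= x ->
  cadlag_markov_process Q (P r x) X r x.
Hypothesis t0 : 0 <= t.
Hypothesis mlam : measurable_fun (`[0, t] : set R) lam.
Hypothesis lamM : forall s, 0 <= s <= t -> 0 <= lam s <= M.

Let phi0 := branching_mechanism0 phi_bm.
Let phi_lip := branching_mechanism_lipschitz phi_bm.

Let pts n := grid_points t mu lam n.
Let U n := point_cumulant v (pts n).

Let pts_ok n : weighted_points t (pts n).
Proof. exact: grid_points_weighted lamM _. Qed.

(** Measurability, positivity and path regularity concern X alone, so they are read off the instance
    started at time 0, which covers all s >= 0. *)
Let mX s : 0 <= s -> measurable_fun setT (X s).
Proof. by move=> s0; have [+ _ _ _ _] := X_markov (lexx 0) (lexx 0); apply. Qed.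

Let X0 s w : 0 <= s -> 0 <= X s w.
Proof. by move=> s0; have [_ + _ _ _] := X_markov (lexx 0) (lexx 0); apply. Qed.

Let X_cadlag w : cadlag_from 0 (X ^~ w).
Proof. by have [_ _ + _ _] := X_markov (lexx 0) (lexx 0); apply. Qed.

Lemma grid_cumulant_bounded :
  exists2 B, 0 <= B & forall n r, 0 <= r <= t -> 0 <= U n r <= B.
Proof.
have arith (a b i s k : R) : a + i = s -> s <= k -> - b <= i -> a <= k + b.
  lra.
have [beta b0 phi_ge] := branching_mechanism_ge phi_bm.
(* K is the total weight of every grid, whatever n; the factor 1 matches [grid_points_sum] for a
   constant function. *)
pose K := \int[mu]_(s in (`[0, t] : set R)) (lam s * 1).
have K0 : 0 <= K.
  apply: Rintegral_ge0 => s; rewrite /= in_itv/= => /lamM/andP[l0 _].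
  by rewrite mulr1.
(* Gronwall's inequality is stated for a positive constant, and [beta] may be zero. *)
have b1 : 0 < beta + 1 by rewrite ltr_wpDl.
exists (2 * K * expR (2 * (beta + 1) * t)).
  by rewrite !mulr_ge0// expR_ge0.
move=> n r rt.
have [M' UM'] := point_cumulant_bounded v_sol (pts_ok n).
have mU := measurable_point_cumulant v_sol (pts_ok n).
have [U0 _] := andP (UM' _ rt); rewrite U0/=.
have UK q : 0 <= q <= t ->
    U n q <= K + (beta + 1) * \int[leb]_(s in `[q, t]) U n s.
  move=> qt; have /andP[q0 q_t] := qt.
  have sub : `[q, t] `<=` `[0, t] by apply: subset_itvr; rewrite bnd_simp.
  have mUq : measurable_fun (`[q, t] : set R) (U n) by exact: measurable_funS mU.
  have UMq s : q <= s <= t -> 0 <= U n s <= M'.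
    by move=> /andP[qs st]; apply: UM'; rewrite st (le_trans q0).
  have iphi := integrable_phi_comp phi_lip mUq UMq.
  have iU : leb.-integrable `[q, t] (EFin \o U n).
    apply: (@bounded_integrable _ _ _ _ _ _ M') => //.
      exact: lebesgue_itv_lty.
    by move=> s /=; rewrite in_itv/= => /UMq/andP[? ?]; rewrite ger0_norm.
  have E := point_cumulant_eq phi_lip phi0 v_sol (pts_ok n) qt.
  have sumK : \sum_(p <- pts n | q <= p.1) p.2 <= K.
    rewrite /K -(@grid_points_sum _ _ _ _ M mlam lamM n (cst 1)).
    rewrite big_mkcond big_seq [X in _ <= X]big_seq.
    apply: ler_sum => p pp; rewrite mulr1; case: ifP => // _.
    by have /andP[/allP/(_ _ pp)/andP[]] := pts_ok n.
  have phiU : - ((beta + 1) * \int[leb]_(s in `[q, t]) U n s) <=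
      \int[leb]_(s in `[q, t]) phi (U n s).
    rewrite -mulNr -RintegralZl//; apply: le_Rintegral => //.
      rewrite (_ : _ \o _ = fun s => ((- (beta + 1))%:E * (EFin \o U n) s)%E)//.
      exact: integrableZl.
    move=> s /=; rewrite in_itv/= => /UMq/andP[Us0 _].
    have := phi_ge _ Us0; rewrite /U in Us0 *; nra.
  exact: arith E sumK phiU.
have := backward_gronwall K0 b1 mU UM' UK rt.
move=> /le_trans; apply; rewrite ler_wpM2l ?mulr_ge0// ler_expR.
rewrite ler_wpM2l ?mulr_ge0 ?(ltW b1)//.
by have /andP[r0 _] := rt; lra.
Qed.

Let A r w := \int[mu]_(s in (`[r, t] : set R)) (lam s * X s w).

Lemma occupation_cvg r w : 0 <= r ->
  \sum_(p <- pts n | r <= p.1) p.2 * X p.1 w @[n --> \oo] --> A r w.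
Proof.
move=> r0; have [C XC] := cadlag_bounded t (X_cadlag w).
have [rc _] := X_cadlag w.
apply: (@grid_points_cvg _ _ _ _ M t0 mlam lamM r `|C| (X ^~ w)) => //.
- by move=> s rs; apply: rc; exact: le_trans rs.
- move=> s /andP[rs st]; apply: le_trans (ler_norm C); apply: XC.
  by rewrite st (le_trans r0).
Qed.

Let Z n r w := expR (- \sum_(p <- pts n | r <= p.1) p.2 * X p.1 w).

Let measurable_Z n r : 0 <= r -> measurable_fun setT (Z n r).
Proof.
move=> r0; apply: (@measurableT_comp _ _ _ _ _ _ expR) => //=.
apply: measurableT_comp => //.
apply: (eq_measurable_fun (fun w => \sum_(p <- pts n)
    if r <= p.1 then p.2 * X p.1 w else 0)).
  by move=> w _; rewrite -big_mkcond.
apply: measurable_sum => p; case: (boolP (r <= p.1)) => [rp|_];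
  last exact: measurable_cst.
by apply: measurable_funM => //; apply: mX; exact: le_trans rp.
Qed.

Let Z_norm n r w : 0 <= r -> `|Z n r w| <= 1.
Proof.
move=> r0; rewrite ger0_norm ?expR_ge0// expR_le1 oppr_le0.
rewrite big_seq_cond; apply: sumr_ge0 => p /andP[pp rp].
apply: mulr_ge0; last by apply: X0; exact: le_trans rp.
by have /andP[/allP/(_ _ pp)/andP[]] := pts_ok n.
Qed.

Let Z_cvg r w : 0 <= r -> Z n r w @[n --> \oo] --> expR (- A r w).
Proof.
move=> r0; apply: (@continuous_cvg _ _ _ _ _ _ expR).
  exact: continuous_expR.
by apply: cvgN; exact: occupation_cvg.
Qed.

Let P_lty r x : (P r x setT < +oo)%E.
Proof. by rewrite ltey_eq fin_num_measure. Qed.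

(** Two values of x are of interest: x = 1 identifies the limit of [U n r], and the given x then
    yields the Laplace formula. *)
Lemma laplace_cvg r x : 0 <= r <= t -> 0 <= x ->
  expR (- (x * U n r)) @[n --> \oo] --> \int[P r x]_w expR (- A r w).
Proof.
move=> /andP[r0 rt] x0.
have -> : (fun n => expR (- (x * U n r))) =
    (fun n => \int[P r x]_w Z n r w).
  apply/funext => n; rewrite /Rintegral.
  by rewrite (laplace_points v_sol Q_laplace (X_markov r0 x0) (pts_ok n)).
apply: (@bounded_convergence _ _ _ _ _ _ _ 1) => //.
- exact: P_lty.
- by move=> n; exact: measurable_Z.
- by move=> n w _; exact: Z_norm.
- by move=> w _; exact: Z_cvg.
Qed.

Lemma expectation_occupation r x : 0 <= r ->
  ('E_(P r x)[fun w => expR (- A r w)%R] = (\int[P r x]_w expR (- A r w))%R%:E)%E.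
Proof.
move=> r0; rewrite unlock /Rintegral fineK//.
apply: integrable_fin_num => //.
apply: (@bounded_integrable _ _ _ _ _ _ 1) => //; first exact: P_lty.
  apply: (measurable_fun_cvg (h := fun n => Z n r)) => //.
    by move=> n; exact: measurable_Z.
  by move=> w _; exact: Z_cvg.
move=> w _; apply: (cvgr_to_le (cvg_norm (@Z_cvg r w r0))).
by apply: nearW => n; exact: Z_norm.
Qed.

(** This is the expected formula at x = 1, solved for u(r). *)
Definition occupation_cumulant r := - ln (\int[P r 1]_w expR (- A r w)).

Lemma grid_cumulant_cvg r : 0 <= r <= t ->
  U n r @[n --> \oo] --> occupation_cumulant r.
Proof.
move=> rt; have [B B0 UB] := grid_cumulant_bounded.
have cv := laplace_cvg rt ler01.
(* The uniform bound B keeps the limit above exp(-B), where the logarithm is continuous. *)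
have e0 : 0 < \int[P r 1]_w expR (- A r w).
  apply: (@lt_le_trans _ _ (expR (- B))); first exact: expR_gt0.
  apply: (cvgr_to_ge cv); apply: nearW => n.
  by rewrite mul1r ler_expR lerN2; have /andP[] := UB n r rt.
have -> : (fun n => U n r) = (fun n => - ln (expR (- (1 * U n r)))).
  by apply/funext => n; rewrite expRK mul1r opprK.
apply: cvgN; apply: (@continuous_cvg _ _ _ _ _ _ (@ln R) _ _ cv).
exact: continuous_ln.
Qed.

Lemma occupation_cumulant_solution :
  bounded_positive_solution phi t mu lam occupation_cumulant.
Proof.
have [B B0 UB] := grid_cumulant_bounded.
have mU n := measurable_point_cumulant v_sol (pts_ok n).
have mu_ : measurable_fun (`[0, t] : set R) occupation_cumulant.
  apply: (measurable_fun_cvg (h := U)) => //.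
  by move=> r /=; rewrite in_itv/=; exact: grid_cumulant_cvg.
have uB r : 0 <= r <= t -> 0 <= occupation_cumulant r <= B.
  move=> rt; have cv := grid_cumulant_cvg rt; apply/andP; split.
    by apply: (cvgr_to_ge cv); apply: nearW => n; have /andP[] := UB n r rt.
  by apply: (cvgr_to_le cv); apply: nearW => n; have /andP[] := UB n r rt.
split=> //; first by exists B.
move=> r rt; have /andP[r0 r_t] := rt.
have sub : `[r, t] `<=` `[0, t] by apply: subset_itvr; rewrite bnd_simp.
have subI s : `[r, t]%classic s -> 0 <= s <= t by move=> /sub /=; rewrite in_itv.
have [C C0 phiC] := bounded_on_itv phi_lip B.
have [g cg gE] := continuous_extension phi_lip B.
have cv1 : U n r + \int[leb]_(s in `[r, t]) phi (U n s) @[n --> \oo] -->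
    occupation_cumulant r + \int[leb]_(s in `[r, t]) phi (occupation_cumulant s).
  apply: cvgD; first exact: grid_cumulant_cvg.
  apply: (@bounded_convergence _ _ _ _ _ _ _ C) => //.
  - exact: lebesgue_itv_lty.
  - move=> n; apply: (measurable_phi_comp phi_lip (B := B)) => //.
      exact: measurable_funS (mU n).
    by move=> s /subI; exact: UB.
  - by move=> n s /subI st; apply: phiC; exact: UB.
  - move=> s /subI st.
    (* All values lie in [0, B], where phi agrees with its continuous extension g. *)
    have -> : (fun n => phi (U n s)) = (fun n => g (U n s)).
      by apply/funext => n; rewrite gE// UB.
    rewrite -gE ?uB//; apply: (@continuous_cvg _ _ _ _ _ _ g); first exact: cg.
    exact: grid_cumulant_cvg.
(* By the atomic equation the same sequence is the weight of the atoms at or after r, to which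
   [grid_points_cvg] applies with g = 1. Uniqueness of the limit gives the equation. *)
have cv2 : U n r + \int[leb]_(s in `[r, t]) phi (U n s) @[n --> \oo] -->
    \int[mu]_(s in (`[r, t] : set R)) lam s.
  have -> : (fun n => U n r + \int[leb]_(s in `[r, t]) phi (U n s)) =
      (fun n => \sum_(p <- pts n | r <= p.1) p.2 * (cst 1 p.1)).
    apply/funext => n.
    rewrite (point_cumulant_eq phi_lip phi0 v_sol (pts_ok n) rt).
    by apply: eq_bigr => p _; rewrite mulr1.
  have -> : \int[mu]_(s in (`[r, t] : set R)) lam s =
      \int[mu]_(s in (`[r, t] : set R)) (lam s * cst 1 s).
    by apply: eq_Rintegral => s _; rewrite mulr1.
  apply: (@grid_points_cvg _ _ _ _ M t0 mlam lamM r 1 (cst 1)) => //.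
    by move=> s _; exact: cvg_cst.
  by move=> s _; rewrite normr1.
exact: cvg_unique cv1 cv2.
Qed.

(** Subtracting the equations cancels the [mu] term. A Lipschitz constant on a common range [0, B]
    bounds |w - u| by its own backward integral, and Gronwall with K = 0 makes it vanish. *)
Lemma bounded_positive_solution_unique u w :
  bounded_positive_solution phi t mu lam u ->
  bounded_positive_solution phi t mu lam w ->
  forall r, 0 <= r <= t -> w r = u r.
Proof.
move=> [mu_ [Bu uB] uE] [mw [Bw wB] wE] r rt.
pose B := Num.max Bu Bw.
have uB' q : 0 <= q <= t -> 0 <= u q <= B.
  by move=> /uB/andP[-> h]; rewrite /B le_max h.
have wB' q : 0 <= q <= t -> 0 <= w q <= B.
  by move=> /wB/andP[-> h]; rewrite /B le_max h orbT.
have [L L0 lip] := phi_lip B.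
have L1 : 0 < L + 1 by rewrite ltr_wpDl.
pose f q := `|w q - u q|.
have mf : measurable_fun (`[0, t] : set R) f.
  by apply: measurableT_comp => //; exact: measurable_funB.
have fB q : 0 <= q <= t -> 0 <= f q <= B.
  move=> qt; rewrite normr_ge0/= ler_norml.
  have /andP[? ?] := uB' _ qt; have /andP[? ?] := wB' _ qt.
  by apply/andP; split; lra.
have fK q : 0 <= q <= t -> f q <= 0 + (L + 1) * \int[leb]_(s in `[q, t]) f s.
  move=> qt; have /andP[q0 q_t] := qt.
  have sub : `[q, t] `<=` `[0, t] by apply: subset_itvr; rewrite bnd_simp.
  have subI s : q <= s <= t -> 0 <= s <= t.
    by move=> /andP[qs ->]; rewrite (le_trans q0).
  have iu : leb.-integrable `[q, t] (EFin \o (phi \o u)).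
    apply: (integrable_phi_comp phi_lip (B := B)).
      exact: measurable_funS mu_.
    by move=> s /subI; exact: uB'.
  have iw : leb.-integrable `[q, t] (EFin \o (phi \o w)).
    apply: (integrable_phi_comp phi_lip (B := B)).
      exact: measurable_funS mw.
    by move=> s /subI; exact: wB'.
  have if_ : leb.-integrable `[q, t] (EFin \o f).
    apply: (@bounded_integrable _ _ _ _ _ _ B) => //.
    - exact: lebesgue_itv_lty.
    - exact: measurable_funS mf.
    - by move=> s /=; rewrite in_itv/= => /subI/fB/andP[? ?]; rewrite ger0_norm.
  have iB : leb.-integrable `[q, t] (EFin \o (fun s => phi (u s) - phi (w s))).
    rewrite (_ : _ \o _ = ((EFin \o (phi \o u)) \- (EFin \o (phi \o w)))%E)//.
    exact: integrableB.
  have -> : f q = `|\int[leb]_(s in `[q, t]) (phi (u s) - phi (w s))|.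
    rewrite RintegralB// /f; congr `|_|.
    by have := uE q qt; have := wE q qt; rewrite /comp; lra.
  rewrite add0r -RintegralZl//; apply: le_trans (le_normr_Rintegral _ iB) _ => //.
  apply: le_Rintegral => //.
  - exact: integrable_norm iB.
  - rewrite (_ : _ \o _ = fun s => ((L + 1)%:E * (EFin \o f) s)%E)//.
    exact: integrableZl.
  - move=> s /=; rewrite in_itv/= => /subI st.
    apply: le_trans (lip _ _ (wB' _ st) (uB' _ st)) _.
    by rewrite /f distrC ler_wpM2r// lerDl.
have := backward_gronwall (lexx 0) L1 mf fB fK rt.
by rewrite mulr0 mul0r normr_le0 subr_eq0 => /eqP.
Qed.

(** The limit of exp(-x U_n(r)) is computed twice: by [laplace_cvg], and from the convergence of
    U_n(r) by continuity of the exponential. *)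
Lemma laplace_occupation r x : 0 <= x -> 0 <= r <= t ->
  ('E_(P r x)[fun w => expR (- A r w)%R] =
  (expR (- (x * occupation_cumulant r)))%:E)%E.
Proof.
move=> x0 rt; have /andP[r0 _] := rt; rewrite expectation_occupation//.
congr (_%:E); apply: cvg_unique (laplace_cvg rt x0) _ => //.
apply: (@continuous_cvg _ _ _ _ _ _ expR); first exact: continuous_expR.
by apply: cvgN; apply: cvgM; [exact: cvg_cst|exact: grid_cumulant_cvg].
Qed.

End weighted_occupation_time.

Theorem theorem4p2 (R : realType) (phi : R -> R)
    (Q : R -> R.-pker (measurableTypeR R) ~> (measurableTypeR R))
    (d : measure_display) (Omega : measurableType d)
    (P : R -> R -> probability Omega R)
    (X : R -> Omega -> measurableTypeR R)
    (t : R) (mu : {finite_measure set (measurableTypeR R) -> \bar R})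
    (lam : R -> R) :
  branching_mechanism phi ->
  cb_semigroup phi Q ->
  (forall r x, 0 <= r -> 0 <= x -> cadlag_markov_process Q (P r x) X r x) ->
  0 <= t ->
  mu (~` `[0, t]) = 0%E ->
  measurable_fun (`[0, t] : set (measurableTypeR R))
    (lam : measurableTypeR R -> measurableTypeR R) ->
  (exists M, forall s, 0 <= s <= t -> 0 <= lam s <= M) ->
  exists u : R -> R,
    [/\ bounded_positive_solution phi t mu lam u,
        (forall w : R -> R, bounded_positive_solution phi t mu lam w ->
           forall r, 0 <= r <= t -> w r = u r)
      & forall r x, 0 <= x -> 0 <= r <= t ->
          ('E_(P r x)[fun w =>
              expR (- \int[mu]_(s in `[r, t]) (lam s * X s w))%R]
            = (expR (- (x * u r)))%:E)%E].
Proof.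
move=> phi_bm [v v_sol Q_laplace] X_markov t0 _ mlam [M lamM].
have u_sol := occupation_cumulant_solution mu phi_bm v_sol Q_laplace X_markov t0
  mlam lamM.
exists (occupation_cumulant P X t mu lam); split=> //.
- move=> w w_sol r rt.
  exact: (bounded_positive_solution_unique phi_bm u_sol w_sol rt).
- move=> r x x0 rt.
  have H := laplace_occupation mu phi_bm v_sol Q_laplace X_markov t0 mlam lamM
    x0 rt.
  exact H.
Qed.
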